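(* Let $d\ge 1$ be an integer, let $T>0$, let $H_1,H_2\in(0,1)$, and let $\mathbf{k}=(k_1,\dots,k_d)$ be a multi-index of nonnegative integers with $|\mathbf{k}|=\sum_{i=1}^d k_i$. Assume that $X^{H_1}=\{X^{H_1}_t:\, t\ge 0\}$ and $\widetilde{X}^{H_2}=\{\widetilde{X}^{H_2}_t:\, t\ge 0\}$ are two independent $d$-dimensional centered Gaussian processes in the class $G^d_{1}$ with parameters $H_1$ and $H_2$, respectively. Assume further that (i) $|\mathbf{k}|$ is even, or (ii) $\mathbb{E}[X^{H_1,1}_tX^{H_1,1}_s]\ge 0$ and $\mathbb{E}[\widetilde{X}^{H_2,1}_t\widetilde{X}^{H_2,1}_s]\ge 0$ for any $0<s,t<T$, where $X^{H_1,1}$ and $\widetilde{X}^{H_2,1}$ denote the first components. Then, if $\frac{H_1H_2}{H_1+H_2}(2|\mathbf{k}|+d)\ge 1$, there exists a positive constant $c_3$ such that $$\liminf_{\varepsilon\downarrow 0}\frac{\mathbb{E}\big[|L^{(\mathbf{k})}_{\varepsilon}(T,0)|^2\big]}{h^{d,|\mathbf{k}|}_{H_1,H_2}(\varepsilon)}\ \ge\ c_3,$$ where $$h^{d,|\mathbf{k}|}_{H_1,H_2}(\varepsilon)=\begin{cases}\varepsilon^{\frac{H_1+H_2}{2H_1H_2}-\frac{d}{2}-|\mathbf{k}|} & \text{if } \frac{H_1H_2}{H_1+H_2}(2|\mathbf{k}|+d)>1,\\[4pt] \ln\big(1+\varepsilon^{-\frac12}\big) & \text{if } \frac{H_1H_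2}{H_1+H_2}(2|\mathbf{k}|+d)=1.\end{cases}$$
   Context: Class $G^d_1$. For $H\in(0,1)$, a $d$-dimensional centered Gaussian process $X^H=\{X^H_t: t\ge 0\}$ belongs to $G^d_1$ with parameter $H$ if its components $X^{H,\ell}$ ($1\le \ell\le d$) are independent and identically distributed and satisfy (P1) for any $T>0$ there exist two positive constants $\kappa_{T,1,H}\le\kappa_{T,2,H}$, depending only on $T$ and $H$, such that for any $0\le s<t<T$, $$\kappa_{T,1,H}(t-s)^{2H}\le \mathbb{E}\big[(X^{H,\ell}_t-X^{H,\ell}_s)^2\big]\le \kappa_{T,2,H}(t-s)^{2H}.$$ Approximate derivatives of local time. For $\varepsilon>0$ let $p_\varepsilon(x)=\frac{1}{(2\pi\varepsilon)^{d/2}}e^{-\frac{|x|^2}{2\varepsilon}}$, $x\in\mathbb{R}^d$, where $|x|$ is the Euclidean norm, and $$p^{(\mathbf{k})}_\varepsilon(x)=\frac{\partial^{|\mathbf{k}|}}{\partial x_1^{k_1}\cdots\partial x_d^{k_d}}p_\varepsilon(x).$$ For $T>0$ and $x\in\mathbb{R}^d$ define $$L^{(\mathbf{k})}_\varepsilon(T,x)=\int_0^T\int_0^T p^{(\mathbf{k})}_\varepsilon\big(X^{H_1}_t-\widetilde{X}^{H_2}_s+x\big)\,ds\,dt.$$ (By (P1) the processes admit versions with continuous paths; the integral is understood for such versions.) *)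

(* Defs.v *)
From HB Require Import structures.
From mathcomp Require Import all_boot all_order all_algebra.
From mathcomp Require Import all_classical all_reals all_analysis.

Set Implicit Arguments.
Unset Strict Implicit.
Unset Printing Implicit Defensive.

Import Order.TTheory GRing.Theory Num.Theory.
Import numFieldNormedType.Exports.

Local Open Scope classical_set_scope.
Local Open Scope ring_scope.

Definition sigma_of {I Omega : Type} {R : realType} (D : set I)
    (Y : I -> Omega -> R) : set (set Omega) :=
  <<s \bigcup_(i in D) preimage_set_system setT (Y i) measurable >>.

(* A d-dimensional process X is a family of random variables X l t, with l the
   component and t the time.  The time index has type R, but every definition
   below looks only at times t >= 0: the values at negative times are junk. *)

Section Processes.
Context {dO : measure_display} {Omega : measurableType dO} {R : realType}.
Variable P : probability Omega R.

Definition independent_classes (I : finType) (G : I -> set (set Omega)) : Prop :=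
  forall (J : {set I}) (A : I -> set Omega), (forall i, G i (A i)) ->
    P (\bigcap_(i in [set` J]) A i) = (\prod_(i in J) P (A i))%E.

(* The library's normal_prob m s takes the standard deviation s, and for s = 0
   it is the uniform law on [0, 1], whence the explicit Dirac case. *)
Definition is_gaussian (Y : Omega -> R) : Prop :=
  exists m s : R, 0 <= s /\ forall A : set R, measurable A ->
    P (Y @^-1` A) = if s == 0 then \d_m A else normal_prob m s A.

Variable d : nat.
Implicit Types X Y : 'I_d -> R -> {RV P >-> R}.

Definition gaussian_process X : Prop :=
  forall (n : nat) (l : 'I_n -> 'I_d) (t a : 'I_n -> R), (forall j, 0 <= t j) ->
    is_gaussian (fun w => \sum_(j < n) a j * X (l j) (t j) w).

Definition centered X : Prop :=
  forall l t, 0 <= t -> ('E_P[X l t] = 0)%E.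

Definition sigma_comp X (l : 'I_d) : set (set Omega) :=
  sigma_of [set t : R | 0 <= t] (fun t => X l t : Omega -> R).

Definition sigma_process X : set (set Omega) :=
  sigma_of [set i : 'I_d * R | 0 <= i.2] (fun i => X i.1 i.2 : Omega -> R).

Definition components_independent X : Prop := independent_classes (sigma_comp X).

(* Equality of the laws of the components on path space, whose sigma-algebra is
   generated by the evaluations at the times t >= 0. *)
Definition components_identically_distributed X : Prop :=
  forall (l l' : 'I_d) (A : set (R -> R)),
    sigma_of [set t : R | 0 <= t] (fun (t : R) (f : R -> R) => f t) A ->
    P [set w | A (fun t => X l t w)] = P [set w | A (fun t => X l' t w)].

Definition property_P1 (H : R) X : Prop :=
  forall T : R, 0 < T -> exists k1 k2 : R, [/\ 0 < k1, k1 <= k2 &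
    forall (l : 'I_d) (s t : R), 0 <= s -> s < t -> t < T ->
      ((k1 * (t - s) `^ (2 * H))%:E <= 'E_P[(fun w => (X l t w - X l s w) ^+ 2)%R])%E /\
      ('E_P[(fun w => (X l t w - X l s w) ^+ 2)%R] <= (k2 * (t - s) `^ (2 * H))%:E)%E].

Definition in_class_G1 (H : R) X : Prop :=
  [/\ gaussian_process X, centered X, components_independent X,
      components_identically_distributed X & property_P1 H X].

Definition independent_processes X Y : Prop :=
  forall A B, sigma_process X A -> sigma_process Y B ->
    P (A `&` B) = (P A * P B)%E.

Definition continuous_paths X : Prop :=
  forall (l : 'I_d) (w : Omega), {within `[0, +oo[, continuous (fun t => X l t w)}.

Definition pos_at X (t : R) (w : Omega) : 'rV[R]_d := \row_l X l t w.

End Processes.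

Section LocalTime.
Context {R : realType} (d : nat).

(* The squared Euclidean norm is spelled out: the library's norm on 'rV[R]_d is
   the maximum norm. *)
Definition heat_kernel (eps : R) (x : 'rV[R]_d) : R :=
  ((2 * pi * eps) `^ (d%:R / 2))^-1 *
  expR (- (\sum_i x 0 i ^+ 2) / (2 * eps)).

Definition partial (i : 'I_d) (f : 'rV[R]_d -> R) : 'rV[R]_d -> R :=
  'D_(delta_mx 0 i : 'rV[R]_d) f.

Definition mpartial (k : 'I_d -> nat) (f : 'rV[R]_d -> R) : 'rV[R]_d -> R :=
  foldr (fun i g => iter (k i) (partial i) g) f (enum 'I_d).

Definition mdegree (k : 'I_d -> nat) : nat := (\sum_(i < d) k i)%N.

Definition path_local_time (k : 'I_d -> nat) (eps T : R)
    (x1 x2 : R -> 'rV[R]_d) (x : 'rV[R]_d) : R :=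
  \int[lebesgue_measure]_(t in `[0, T]) \int[lebesgue_measure]_(s in `[0, T])
    mpartial k (heat_kernel eps) (x1 t - x2 s + x).

End LocalTime.

Definition L_eps {dO : measure_display} {Omega : measurableType dO}
    {R : realType} {P : probability Omega R} {d : nat}
    (X Xt : 'I_d -> R -> {RV P >-> R}) (k : 'I_d -> nat) (eps T : R)
    (x : 'rV[R]_d) (w : Omega) : R :=
  path_local_time k eps T (fun t => pos_at X t w) (fun s => pos_at Xt s w) x.

Definition crit {R : realType} (d K : nat) (H1 H2 : R) : R :=
  H1 * H2 / (H1 + H2) * (2 * K%:R + d%:R).

(* The rate is used only when 1 <= crit d K H1 H2, so that the else branch is
   the case crit d K H1 H2 = 1. *)
Definition h_rate {R : realType} (d K : nat) (H1 H2 eps : R) : R :=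
  if 1 < crit d K H1 H2
  then eps `^ ((H1 + H2) / (2 * H1 * H2) - d%:R / 2 - K%:R)
  else ln (1 + eps `^ (- (1 / 2))).

(* Main.v *)
Require Import Defs.
From HB Require Import structures.
From mathcomp Require Import all_boot all_order all_algebra.
From mathcomp Require Import all_classical all_reals all_analysis.
From mathcomp Require Import measurable_realfun ring lra zify.
Set Implicit Arguments.
Unset Strict Implicit.
Unset Printing Implicit Defensive.
Import Order.TTheory GRing.Theory Num.Theory.
Import numFieldNormedType.Exports.
Local Open Scope classical_set_scope.
Local Open Scope ring_scope.

(* Differentiating the Fourier representation of the heat kernel writes E|L|^2 as
   the integral over (t, s, t', s') of the products over the coordinates of
   Gaussian integrals that only involve the covariance matrix of
   (X_t - Xt_s, X_t' - Xt_s'), shifted by eps on the diagonal.  Completing the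
   square turns each of them into a sum of products of even moments with
   coefficients of the sign of powers of the covariance c, so that their product
   is nonnegative when |k| is even or c >= 0; and where c is bounded below it is
   at least a constant times rho^(-|k| - d/2), for
   rho = |t' - t|^(2 H1) + |s' - s|^(2 H2) + eps.  By (P1) this is the case near the
   diagonal of a small rectangle around some (t0, s0).  Cutting the integral of
   rho^(-|k| - d/2) into dyadic pieces gives a geometric sum over the scales
   2^-n >= eps, whose ratio is at least 1 by the assumption on H1, H2, |k| and d,
   and which has the order of h(eps). *)

(** * Integrals of real functions *)

(** The obstacle is the sign: the derivative of the kernel oscillates, so the quadruple integral can
    be cut down to a small set only once the integrand is known to be nonnegative everywhere. With q
    = c / (b + eps), a coordinate of order m gives a sum over i of terms in q^i times a moment of
    order m - i and one of order m + i. Odd moments vanish, so only the i of the parity of m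
    survive: one factor may well be negative, and replacing q by -q multiplies the product over the
    coordinates by (-1)^|k|. The power of rho comes from the top index i = m: a moment of order 2m
    with precision D, the Schur complement, is of order D^(-m - 1/2). In turn D is at most the
    variance of the increment plus 2 eps, hence at most a constant times rho by (P1). As X_0 need
    not vanish, (P1) does not bound a given variance from below; a time with positive variance is
    found by comparing two times. The n-th dyadic piece has sides of order 2^(-n / (2 H1)) and 2^(-n
    / (2 H2)) and rho there is of order 2^-n, so the ratio of the sum is 2^-gamma, with gamma the
    exponent of eps in h. Fourier analysis stays real: cosines with an arbitrary phase also encode
    sines and derivatives. *)

Section RealIntegrals.
Context {d : measure_display} {T : measurableType d} {R : realType}.
Variable mu : {measure set T -> \bar R}.
Implicit Types f g : T -> R.

Lemma integrable_le_EFin f g : measurable_fun setT f ->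
  (forall x, `|f x| <= g x) -> mu.-integrable setT (EFin \o g) ->
  mu.-integrable setT (EFin \o f).
Proof.
move=> mf fg; apply: le_integrable => //; first exact/measurable_EFinP.
by move=> x _; rewrite /= lee_fin (le_trans (fg x))// ler_norm.
Qed.

Lemma integrable_measurable f : mu.-integrable setT (EFin \o f) ->
  measurable_fun setT f.
Proof. by move/integrableP => [/measurable_EFinP]. Qed.

Lemma integrable_bdM (C : R) f g : measurable_fun setT f ->
  (forall x, `|f x| <= C) -> mu.-integrable setT (EFin \o g) ->
  mu.-integrable setT (EFin \o (fun x => f x * g x)).
Proof.
move=> mf fC ig.
apply: (integrable_le_EFin (g := fun x => C * `|g x|)).
- by apply: measurable_funM => //; exact: integrable_measurable ig.
- by move=> x; rewrite normrM ler_wpM2r.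
- by have := integrableZl measurableT C (integrable_norm ig).
Qed.

Lemma integrable_Zl c f : mu.-integrable setT (EFin \o f) ->
  mu.-integrable setT (EFin \o (fun x => c * f x)).
Proof. by move=> h; apply: (integrable_bdM (C := `|c|)). Qed.

Lemma integrable_D f g : mu.-integrable setT (EFin \o f) ->
  mu.-integrable setT (EFin \o g) ->
  mu.-integrable setT (EFin \o (fun x => f x + g x)).
Proof. by move=> h1 h2; have := integrableD measurableT h1 h2. Qed.

Lemma integrable_bigsum (I : Type) (s : seq I) (F : I -> T -> R) :
  (forall i, mu.-integrable setT (EFin \o F i)) ->
  mu.-integrable setT (EFin \o (fun x => \sum_(i <- s) F i x)).
Proof.
move=> iF; rewrite (_ : _ \o _ = (fun x => \sum_(i <- s) (EFin \o F i) x)%E).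
  exact: integrable_sum.
by apply/funext => x /=; rewrite sumEFin.
Qed.

Lemma Rintegral_bigsum (I : Type) (s : seq I) (F : I -> T -> R) :
  (forall i, mu.-integrable setT (EFin \o F i)) ->
  \int[mu]_x (\sum_(i <- s) F i x) = \sum_(i <- s) \int[mu]_x F i x.
Proof.
move=> iF; elim: s => [|i s ih].
  rewrite big_nil (_ : (fun _ => _) = cst 0) ?Rintegral_cst ?mul0r//.
  by apply/funext => x; rewrite big_nil.
rewrite big_cons -ih -RintegralD//; last exact: integrable_bigsum.
by apply: eq_Rintegral => x _; rewrite big_cons.
Qed.

Lemma Rintegral_le_norm (f g : T -> R) : measurable_fun setT f ->
  (forall x, `|f x| <= g x) -> mu.-integrable setT (EFin \o g) ->
  `|\int[mu]_x f x| <= \int[mu]_x g x.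
Proof.
move=> mf fg ig; have ifn := integrable_le_EFin mf fg ig.
apply: le_trans (le_normr_Rintegral measurableT ifn) _.
by apply: le_Rintegral => //; exact: integrable_norm.
Qed.

End RealIntegrals.

Section Transfer.
Context {d1 d2 : measure_display} {T1 : measurableType d1}
  {T2 : measurableType d2} {R : realType}.
Variables (mu : {measure set T1 -> \bar R}) (nu : {measure set T2 -> \bar R}).

(** The common change of variables: the hypothesis on preimages covers translations and the
    reflection of Lebesgue measure, the law of a Gaussian variable and the joint law of an
    independent pair. *)
Lemma law_transfer (Y : T1 -> T2) (f : T2 -> R) : measurable_fun setT Y ->
  (forall A, measurable A -> mu (Y @^-1` A) = nu A) ->
  nu.-integrable setT (EFin \o f) ->
  mu.-integrable setT (EFin \o (f \o Y)) /\
  \int[mu]_x f (Y x) = \int[nu]_y f y.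
Proof.
move=> mY law inf; have mf := integrable_measurable inf.
have ifY : mu.-integrable setT (EFin \o (f \o Y)).
  apply/integrableP; split.
    by apply/measurable_EFinP; exact: measurableT_comp.
  have /integrableP[_ h] := inf.
  rewrite (_ : (\int[mu]_x _ = \int[nu]_x `|(EFin \o f) x|)%E)//.
  transitivity (\int[pushforward mu Y]_y `|(EFin \o f) y|)%E.
    rewrite (ge0_integral_pushforward mY)//=.
    by apply/measurable_EFinP; exact: measurableT_comp.
  by apply: eq_measure_integral => // A mA _; exact: law.
split=> //; congr fine.
transitivity (\int[pushforward mu Y]_y (f y)%:E)%E.
  by rewrite (integral_pushforward mY)//; exact/measurable_EFinP.
by apply: eq_measure_integral => // A mA _; exact: law.
Qed.

End Transfer.

Section LebesgueInvariance.
Context {R : realType}.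
Local Notation mu := (@lebesgue_measure R).

(** Lebesgue measure is determined by its values on intervals, so only the length of a translated
    interval has to be computed. *)
Lemma lebesgue_measure_shift (a : R) (A : set R) : measurable A ->
  mu ((fun x : R => x + a) @^-1` A) = mu A.
Proof.
move=> mA; pose phi : measurableTypeR R -> measurableTypeR R := fun x => x + a.
have mphi : measurable_fun setT phi by exact: measurable_funD.
rewrite -[LHS]/(pushforward mu phi A).
apply/esym/lebesgue_measure_unique => //= _ [[u v]] _ <-.
rewrite /pushforward (_ : phi @^-1` _ = `]u - a, v - a]%classic).
  rewrite !lebesgue_measure_itv/= !lte_fin ltrD2r.
  rewrite -!EFinD; case: ifP => // _; congr EFin; ring.
apply/seteqP; split=> x; rewrite /= !in_itv/= /phi => /andP[h1 h2].
  by apply/andP; split; lra.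
by apply/andP; split; lra.
Qed.

Lemma integral_shift (a : R) (f : R -> R) : mu.-integrable setT (EFin \o f) ->
  mu.-integrable setT (EFin \o (fun x => f (x + a))) /\
  \int[mu]_x f (x + a) = \int[mu]_x f x.
Proof.
move=> fi.
have mphi : measurable_fun setT ((fun x => x + a) : measurableTypeR R -> measurableTypeR R).
  exact: measurable_funD.
exact: (@law_transfer _ _ _ _ _ mu mu _ f mphi (@lebesgue_measure_shift a) fi).
Qed.

Lemma integral_opp (f : R -> R) : mu.-integrable setT (EFin \o f) ->
  mu.-integrable setT (EFin \o (fun x => f (- x))) /\
  \int[mu]_x f (- x) = \int[mu]_x f x.
Proof.
move=> fi.
have mphi : measurable_fun setT (-%R : measurableTypeR R -> measurableTypeR R).
  exact: oppr_measurable.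
exact: (@law_transfer _ _ _ _ _ mu mu _ f mphi (@lebesgue_measureN R) fi).
Qed.

Lemma Rintegral_odd (f : R -> R) : mu.-integrable setT (EFin \o f) ->
  (forall x, f (- x) = - f x) -> \int[mu]_x f x = 0.
Proof.
move=> ifn fN; have [_] := integral_opp ifn.
rewrite (_ : (fun x => f (- x)) = (fun x => -1 * f x)); last first.
  by apply/funext => x; rewrite fN mulN1r.
by rewrite RintegralZl//; lra.
Qed.

(** * Moments of the unnormalised Gaussian weight of precision e *)

Definition gmono (e : R) (n : nat) (y : R) : R :=
  y ^+ n * expR (- (e * y ^+ 2 / 2)).

Lemma gmonoS e n y : gmono e n.+1 y = y * gmono e n y.
Proof. by rewrite /gmono exprS mulrA. Qed.

Lemma continuous_gmono e n : continuous (gmono e n).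
Proof.
move=> x; apply: cvgM; first exact: exprn_continuous.
apply: (cvg_comp _ expR); last exact: continuous_expR.
apply: (@cvgN _ R^o).
apply: cvgM; last exact: cvg_cst.
by apply: cvgM; [exact: cvg_cst|exact: sqr_continuous].
Qed.

Lemma measurable_gmono e n : measurable_fun setT (gmono e n).
Proof. by apply: continuous_measurable_fun; exact: continuous_gmono. Qed.

Lemma gmono0_normal e y : 0 < e ->
  gmono e 0 y = normal_fun 0 (Num.sqrt e)^-1 y.
Proof.
move=> e0; rewrite /gmono /normal_fun mul1r subr0; congr expR.
rewrite exprVn sqr_sqrtr ?ltW//.
by field; rewrite gt_eqF.
Qed.

Lemma gmono0_int e : 0 < e ->
  mu.-integrable setT (EFin \o gmono e 0) /\
  \int[mu]_y gmono e 0 y = Num.sqrt (2 * pi / e).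
Proof.
move=> e0; set s := (Num.sqrt e)^-1.
have s0 : s != 0 by rewrite invr_eq0 gt_eqF// sqrtr_gt0.
have p0 := normal_peak_gt0 s0.
have E : gmono e 0 = (fun y => (normal_peak s)^-1 * normal_pdf 0 s y).
  apply/funext => y; rewrite normal_pdfE// mulKf ?gt_eqF//.
  exact: gmono0_normal.
split.
  by rewrite E; apply: integrable_Zl; exact: integrable_normal_pdf.
rewrite E RintegralZl//; last exact: integrable_normal_pdf.
rewrite /Rintegral integral_normal_pdf mulr1 invrK /s exprVn sqr_sqrtr ?ltW//.
by congr Num.sqrt; rewrite mulrC -mulr_natl; ring.
Qed.

(** Half of the exponent absorbs the extra factor: [|y| * expR (- (e / 4 * y ^+ 2))] is at most
    [1 + 4 / e], and the other half leaves [gmono (e / 2) n]. The induction must therefore keep [e]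
    general. *)
Lemma integrable_gmono e n : 0 < e -> mu.-integrable setT (EFin \o gmono e n).
Proof.
elim: n e => [|n ih] e e0; first by have [] := gmono0_int e0.
have e20 : 0 < e / 2 by rewrite divr_gt0.
apply: (@integrable_le_EFin _ _ R mu _ (fun y => (1 + 4 / e) * `|gmono (e / 2) n y|)).
- exact: measurable_gmono.
- move=> y; rewrite /gmono exprS -mulrA normrM !(normrM (y ^+ n)) mulrCA.
  rewrite [leRHS]mulrCA ler_wpM2l// !(ger0_norm (expR_ge0 _)).
  rewrite (_ : expR (- (e * y ^+ 2 / 2)) =
    expR (- (e / 4 * y ^+ 2)) * expR (- (e / 2 * y ^+ 2 / 2))); last first.
    by rewrite -expRD; congr expR; lra.
  rewrite mulrA ler_wpM2r ?expR_ge0// expRN ler_pdivrMr ?expR_gt0//.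
  apply: (@le_trans _ _ ((1 + 4 / e) * (1 + e / 4 * y ^+ 2))); last first.
    by rewrite ler_wpM2l ?expR_ge1Dx// addr_ge0// divr_ge0// ltW.
  have -> : (1 + 4 / e) * (1 + e / 4 * y ^+ 2) =
      1 + 4 / e + e / 4 * y ^+ 2 + y ^+ 2 by field; rewrite gt_eqF.
  have : 0 <= 4 / e by rewrite divr_ge0// ltW.
  have : 0 <= e / 4 * y ^+ 2 by rewrite mulr_ge0 ?sqr_ge0// divr_ge0// ltW.
  have : `|y| <= 1 + y ^+ 2.
    rewrite -[y ^+ 2]real_normK ?num_real//.
    have := sqr_ge0 (`|y| - 1); nra.
  lra.
- by apply: integrable_Zl; exact: integrable_norm (ih _ e20).
Qed.

Lemma gmonoN e n y : gmono e n (- y) = (-1) ^+ n * gmono e n y.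
Proof. by rewrite /gmono sqrrN [(- y) ^+ n]exprNn; ring. Qed.

Definition gmom e n := \int[mu]_y gmono e n y.

Lemma gmom_odd e n : 0 < e -> odd n -> gmom e n = 0.
Proof.
move=> e0 on; apply: Rintegral_odd; first exact: integrable_gmono.
by move=> y; rewrite gmonoN -signr_odd on mulN1r.
Qed.

Lemma gmono_even_ge0 e n y : ~~ odd n -> 0 <= gmono e n y.
Proof. by move=> en; rewrite mulr_ge0 ?expR_ge0// exprn_even_ge0. Qed.

Lemma gmom_even_ge0 e n : ~~ odd n -> 0 <= gmom e n.
Proof. by move=> en; apply: Rintegral_ge0 => y _; exact: gmono_even_ge0. Qed.

(* Keep only the interval [1/sqrt e, 2/sqrt e]. *)
Lemma gmom_even_lb e n : 0 < e ->
  expR (-2) * ((Num.sqrt e)^-1) ^+ (2 * n).+1 <= gmom e (2 * n).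
Proof.
move=> e0; set s := (Num.sqrt e)^-1.
have s0 : 0 < s by rewrite invr_gt0 sqrtr_gt0.
have se : e * s ^+ 2 = 1.
  by rewrite exprVn sqr_sqrtr ?mulfV ?gt_eqF// ltW.
have mI : measurable `[s, 2 * s]%classic by [].
have E : \int[mu]_(y in `[s, 2 * s]) (expR (-2) * s ^+ (2 * n)) =
    expR (-2) * s ^+ (2 * n).+1.
  rewrite Rintegral_cst//.
  rewrite (_ : fine _ = s) ?exprS; first by ring.
  apply: (congr1 fine (y := s%:E)); apply: etrans (lebesgue_measure_itv _) _.
  rewrite /= lte_fin ifT; last by rewrite ltr_pMl// ltr1n.
  by rewrite -EFinB; congr EFin; ring.
rewrite -E Rintegral_mkcond; apply: le_Rintegral => //.
- have [h _] := @integrable_mkcond _ _ R mu _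
    (EFin \o cst (expR (-2) * s ^+ (2 * n))) mI.
  rewrite -restrict_EFin; apply: h.
  apply: continuous_compact_integrable; first exact: segment_compact.
  by apply: continuous_subspaceT => ?; exact: cst_continuous.
- exact: integrable_gmono.
move=> y _; rewrite patchE; case: ifPn => [|_]; last first.
  by apply: gmono_even_ge0; rewrite mul2n odd_double.
rewrite inE/= in_itv/= => /andP[h1 h2]; rewrite /gmono mulrC.
have y0 : 0 <= y by lra.
apply: ler_pM; rewrite ?expR_ge0 ?exprn_ge0//; first exact: ltW.
- by rewrite lerXn2r// nnegrE ltW.
- rewrite ler_expR lerN2.
  have : y ^+ 2 <= 4 * s ^+ 2 by nra.
  nra.
Qed.

End LebesgueInvariance.

(** * Cosine transforms of Gaussian moments *)

Section GaussianFourier.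
Context {R : realType}.
Local Notation mu := (@lebesgue_measure R).

Lemma is_derive_expR_comp (f : R -> R) (x df : R) : is_derive x 1 f df ->
  is_derive x 1 (fun y => expR (f y)) (expR (f x) * df).
Proof. by move=> df'; exact: (is_derive1_comp (is_derive_expR (f x)) df'). Qed.

Lemma is_derive_cos_comp (f : R -> R) (x df : R) : is_derive x 1 f df ->
  is_derive x 1 (fun y => cos (f y)) (- sin (f x) * df).
Proof. by move=> df'; exact: (is_derive1_comp (is_derive_cos (f x)) df'). Qed.

Lemma is_derive_sin_comp (f : R -> R) (x df : R) : is_derive x 1 f df ->
  is_derive x 1 (fun y => sin (f y)) (cos (f x) * df).
Proof. by move=> df'; exact: (is_derive1_comp (is_derive_sin (f x)) df'). Qed.

Lemma is_derive_mul (f g : R -> R) (x df dg : R) :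
  is_derive x 1 f df -> is_derive x 1 g dg ->
  is_derive x 1 (fun y => f y * g y) (f x * dg + g x * df).
Proof. by move=> hf hg; exact: (is_deriveM hf hg). Qed.

Lemma is_derive_affine (a b x : R) : is_derive x 1 (fun y => y * a + b) a.
Proof.
have h := is_deriveD (is_deriveM (is_derive_id x 1) (is_derive_cst a x 1))
  (is_derive_cst b x 1).
apply: (is_derive_eq (h : is_derive x 1 (fun y => y * a + b) _)).
by rewrite scaler0 add0r addr0 /cst /GRing.scale/= mulr1.
Qed.

Lemma is_derive_affinel (a b x : R) : is_derive x 1 (fun y => a * y + b) a.
Proof.
rewrite (_ : (fun y => a * y + b) = (fun y => y * a + b)).
  exact: is_derive_affine.
by apply/funext => y; rewrite mulrC.
Qed.

Lemma is_derive_quad (a x : R) : is_derive x 1 (fun y => a * y ^+ 2) (2 * a * x).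
Proof.
have h := is_derive_mul (is_derive_affinel a 0 x) (is_derive_affinel 1 0 x).
rewrite (_ : (fun y => a * y ^+ 2) = (fun y => (a * y + 0) * (1 * y + 0))).
  by apply: (is_derive_eq h); ring.
by apply/funext => y; ring.
Qed.

Lemma is_derive_gmono0 (e x : R) :
  is_derive x 1 (gmono e 0) (- e * gmono e 1 x).
Proof.
rewrite (_ : gmono e 0 = (fun y => expR (- (e / 2) * y ^+ 2))).
  apply: (is_derive_eq (is_derive_expR_comp (is_derive_quad (- (e / 2)) x))).
  rewrite /gmono expr1 (_ : - (e / 2) * x ^+ 2 = - (e * x ^+ 2 / 2)); last by ring.
  by rewrite (_ : 2 * - (e / 2) = - e); [ring|field].
by apply/funext => y; rewrite /gmono expr0 mul1r; congr expR; ring.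
Qed.

Lemma continuous_cos_affine (a b : R) : continuous (fun y : R => cos (a * y + b)).
Proof.
move=> y; apply: differentiable_continuous.
by apply/derivable1_diffP; case: (is_derive_cos_comp (is_derive_affinel a b y)).
Qed.

Lemma measurable_cos_affine (a b : R) :
  measurable_fun setT (fun y : R => cos (a * y + b)).
Proof. by apply: continuous_measurable_fun; exact: continuous_cos_affine. Qed.

(* (2 pi)^-1 * fcos e m is the m-th derivative of the heat kernel of variance e
   on the line, written as a cosine transform: differentiating cos m times adds
   m pi / 2 to its phase. *)
Definition fcos (e : R) (m : nat) (u : R) : R :=
  \int[mu]_y (cos (u * y + m%:R * (pi / 2)) * gmono e m y).

Lemma integrable_cos_gmono (e a b : R) m : 0 < e ->
  mu.-integrable setT (EFin \o (fun y => cos (a * y + b) * gmono e m y)).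
Proof.
move=> e0; apply: (@integrable_bdM _ _ R mu 1).
- exact: measurable_cos_affine.
- by move=> y; exact: cos_max.
- exact: integrable_gmono.
Qed.

Lemma fcos_bounded (e u : R) m : 0 < e ->
  `|fcos e m u| <= \int[mu]_y `|gmono e m y|.
Proof.
move=> e0; apply: Rintegral_le_norm.
- by apply: measurable_funM;
    [exact: measurable_cos_affine|exact: measurable_gmono].
- by move=> y; rewrite normrM ler_piMl// cos_max.
- by apply: integrable_norm; exact: integrable_gmono.
Qed.

Lemma cos_halfpi_succ (z : R) m :
  cos (z + m.+1%:R * (pi / 2)) = - sin (z + m%:R * (pi / 2)).
Proof. by rewrite -cosDpihalf; congr cos; rewrite -natr1; ring. Qed.

Lemma is_derive_fcos (e u : R) m : 0 < e ->
  is_derive u 1 (fcos e m) (fcos e m.+1 u).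
Proof.
move=> e0.
pose f (x y : R) := cos (x * y + m%:R * (pi / 2)) * gmono e m y.
have fd (x y : R) : is_derive x 1 (f ^~ y)
    (cos (x * y + m.+1%:R * (pi / 2)) * gmono e m.+1 y).
  have h := is_derive_mul
    (is_derive_cos_comp (is_derive_affine y (m%:R * (pi / 2)) x))
    (is_derive_cst (gmono e m y) x 1).
  apply: (is_derive_eq (h : is_derive x 1 (f ^~ y) _)).
  by rewrite cos_halfpi_succ gmonoS /cst; ring.
(* Any interval around [u] would do, since the dominating function [|gmono e m.+1 y|] does not
   depend on [x]. *)
have Iu : `]u - 1, u + 1[%classic u by rewrite /= in_itv/=; apply/andP; split; lra.
have fi x : `]u - 1, u + 1[%classic x -> mu.-integrable setT (EFin \o f x).
  by move=> _; exact: integrable_cos_gmono.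
have fdd x y : `]u - 1, u + 1[%classic x -> setT y -> derivable (f ^~ y) x 1.
  by move=> _ _; case: (fd x y).
have fb x y : `]u - 1, u + 1[%classic x -> setT y ->
    `|partial1of2 f x y| <= `|gmono e m.+1 y|.
  move=> _ _; rewrite partial1of2E; have [_ ->] := fd x y.
  by rewrite normrM ler_piMl// cos_max.
have ig : mu.-integrable setT (EFin \o (fun y => `|gmono e m.+1 y|)).
  by apply: integrable_norm; exact: integrable_gmono.
have g0 y : 0 <= `|gmono e m.+1 y| by [].
split.
  exact: (derivable_under_integral measurableT Iu fi fdd g0 ig fb).
rewrite -derive1E (differentiation_under_integral measurableT Iu fi fdd g0 ig fb).
by apply: eq_Rintegral => y _; rewrite partial1of2E; have [_ ->] := fd u y.
Qed.

(** A crude decay, from [1 + x <= expR x], that suffices to make the boundary terms of an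
    integration by parts vanish. *)
Lemma gmono0_le (e : R) (n : nat) : 0 < e ->
  gmono e 0 n.+1%:R <= 2 / e * harmonic n.
Proof.
move=> e0; rewrite /gmono expr0 mul1r expRN -[X in _ <= X]invrK.
have n0 : (0 : R) < n.+1%:R by [].
rewrite lef_pV2 ?posrE ?expR_gt0 ?invr_gt0 ?mulr_gt0 ?invr_gt0//.
apply: le_trans (expR_ge1Dx _).
rewrite /harmonic/= invrM ?invrK ?unitfE ?gt_eqF ?mulr_gt0 ?invr_gt0//.
rewrite invf_div.
have : (1 : R) <= n.+1%:R by rewrite ler1n.
move: (n.+1%:R : R) => x x1.
have : 0 <= e * (x * (x - 1)).
  by apply: mulr_ge0; [exact: ltW|apply: mulr_ge0; lra].
lra.
Qed.

(* Integrate over [-n, n] and let n tend to infinity. *)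
Lemma Rintegral_deriv0 (e : R) (h h' : R -> R) : 0 < e ->
  (forall y : R, is_derive y 1 h (h' y)) -> continuous h' ->
  mu.-integrable setT (EFin \o h') ->
  (forall y, `|h y| <= gmono e 0 y) -> \int[mu]_y h' y = 0.
Proof.
move=> e0 dh ch ih hb.
pose I n := `[- n.+1%:R, n.+1%:R]%classic : set R.
pose f_ n := EFin \o (h' \_ (I n)).
have mI n : measurable (I n) by exact: measurable_itv.
have mh := integrable_measurable ih.
have mf n : measurable_fun setT (f_ n).
  by apply/measurable_EFinP; apply/(measurable_restrictT _ (mI n)); exact: measurable_funTS.
have cf : {ae mu, forall x, setT x -> f_ ^~ x @ \oo --> (EFin \o h') x}.
  apply: aeW => x _; apply: cvg_near_cst.
  exists (Num.bound `|x|) => // n /= nx; rewrite /f_/= patchE ifT// inE /I/= in_itv/=.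
  rewrite -ler_norml (le_trans (ltW (archi_boundP (normr_ge0 x))))//.
  by rewrite ler_nat leqW.
have bf : {ae mu, forall x n, setT x -> (`|f_ n x| <= (`|h' x|%R)%:E)%E}.
  apply: aeW => x n _; rewrite /f_/= patchE lee_fin.
  by case: ifP => // _; rewrite normr0.
have [_ _ cv] := @dominated_convergence _ _ R mu setT measurableT _ _ _ mf
  (measurable_int _ ih) cf (integrable_norm ih) bf.
have E n : (\int[mu]_x f_ n x)%E = (h n.+1%:R - h (- n.+1%:R))%:E.
  rewrite /f_ -restrict_EFin -integral_mkcond (@continuous_FTC2 _ h' h)//.
  - by have := ltr0Sn R n; lra.
  - by apply: continuous_subspaceT.
  - split.
    + by move=> x _; case: (dh x).
    + apply: cvg_at_right_filter.
      by apply: differentiable_continuous; apply/derivable1_diffP; case: (dh (- n.+1%:R)).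
    + apply: cvg_at_left_filter.
      by apply: differentiable_continuous; apply/derivable1_diffP; case: (dh n.+1%:R).
  - by move=> x _; rewrite derive1E; case: (dh x).
have c0 : h n.+1%:R - h (- n.+1%:R) @[n --> \oo] --> 0.
  apply: norm_cvg0.
  apply: (@squeeze_cvgr _ _ _ _ (cst 0) (fun n => 4 / e * harmonic n)).
  - apply: nearW => n; rewrite normr_ge0/=.
    apply: le_trans (ler_normB _ _) _.
    have := hb n.+1%:R; have := hb (- n.+1%:R).
    rewrite gmonoN expr0 mul1r; have := gmono0_le n e0.
    by rewrite /harmonic/= -!mulrA; move: (e^-1 * _) => z; lra.
  - exact: cvg_cst.
  - rewrite -[X in _ --> X](mulr0 (4 / e)); apply: cvgM; first exact: cvg_cst.
    exact: cvg_harmonic.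
have c1 : (\int[mu]_x f_ n x)%E @[n --> \oo] --> 0%E.
  under eq_fun do rewrite E.
  by apply: cvg_EFin => //; exact: nearW.
by rewrite /Rintegral -(cvg_unique _ c1 cv).
Qed.

(** The derivative in [y] of [sin (u * y) * gmono e 0 y] integrates to 0. As [fcos e 1] is the
    derivative of [fcos e 0], this is a linear differential equation of first order for
    [fcos e 0]. *)
Lemma fcos_ode (e u : R) : 0 < e -> e * fcos e 1 u = - u * fcos e 0 u.
Proof.
move=> e0.
pose h y := sin (u * y + 0) * gmono e 0 y.
pose h' y := e * (cos (u * y + pi / 2) * gmono e 1 y) +
             u * (cos (u * y + 0) * gmono e 0 y).
have i0 := integrable_cos_gmono u 0 0 e0.
have i1 := integrable_cos_gmono u (pi / 2) 1 e0.
have : \int[mu]_y h' y = 0.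
  apply: (Rintegral_deriv0 (h := h) e0).
  - move=> y.
    have hh := is_derive_mul (is_derive_sin_comp (is_derive_affinel u 0 y))
      (is_derive_gmono0 e y).
    apply: (is_derive_eq (hh : is_derive y 1 h _)).
    by rewrite /h' cosDpihalf addr0; ring.
  - move=> y; apply: cvgD; apply: cvgM; try exact: cvg_cst; apply: cvgM.
    + exact: continuous_cos_affine.
    + exact: continuous_gmono.
    + exact: continuous_cos_affine.
    + exact: continuous_gmono.
  - by apply: (@integrable_D _ _ R mu); apply: (@integrable_Zl _ _ R mu).
  - move=> y; rewrite /h normrM (ger0_norm (gmono_even_ge0 _ _ _))//.
    by rewrite ler_piMl ?gmono_even_ge0// sin_max.
rewrite RintegralD//; try exact: (@integrable_Zl _ _ R mu).
rewrite !RintegralZl// => E.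
rewrite /fcos mul1r mul0r; lra.
Qed.

(** With the integrating factor [expR (u ^+ 2 / (2 * e))] the equation [fcos_ode] says that the
    product [G] has derivative 0; its constant value is read at 0. *)
Lemma fcos0E (e u : R) : 0 < e ->
  fcos e 0 u = Num.sqrt (2 * pi / e) * expR (- (u ^+ 2 / (2 * e))).
Proof.
move=> e0.
pose G v := fcos e 0 v * expR ((2 * e)^-1 * v ^+ 2).
have dG (v : R) : is_derive v 1 G 0.
  have hh := is_derive_mul (is_derive_fcos v 0 e0)
    (is_derive_expR_comp (is_derive_quad (2 * e)^-1 v)).
  apply: (is_derive_eq (hh : is_derive v 1 G _)).
  have -> : fcos e 1 v = - v * fcos e 0 v / e.
    by rewrite -fcos_ode// mulrC mulKf// gt_eqF.
  by field; rewrite gt_eqF.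
have : G u = G 0 by exact: is_derive_0_is_cst.
rewrite /G expr0n mulr0 expR0 mulr1.
have -> : fcos e 0 0 = Num.sqrt (2 * pi / e).
  have [_ <-] := gmono0_int e0; apply: eq_Rintegral => y _.
  by rewrite !mul0r addr0 cos0 mul1r.
move=> <-; rewrite -mulrA -expRD mulrC (_ : _ + _ = 0) ?expR0 ?mul1r//.
by field; rewrite gt_eqF.
Qed.

(** The second moment is minus [fcos e 2 0], the derivative of [fcos e 1] at 0, and [fcos e 1] is
    explicit by [fcos_ode] and [fcos0E]. *)
Lemma gmom2E (e : R) : 0 < e -> gmom e 2 = Num.sqrt (2 * pi / e) / e.
Proof.
move=> e0.
have h2 := is_derive_fcos 0 1 e0.
pose c := Num.sqrt (2 * pi / e).
have : is_derive (0 : R) 1 (fcos e 1) (- (c / e)).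
  rewrite (_ : fcos e 1 = fun v => (- (c / e) * v + 0) * expR (- (2 * e)^-1 * v ^+ 2)).
    apply: (is_derive_eq (is_derive_mul (is_derive_affinel _ _ _)
      (is_derive_expR_comp (is_derive_quad _ _)))).
    by rewrite expr0n !mulr0 expR0; ring.
  apply/funext => v.
  have -> : fcos e 1 v = - v * fcos e 0 v / e.
    by rewrite -fcos_ode// mulrC mulKf// gt_eqF.
  rewrite fcos0E// -/c addr0 (_ : - (v ^+ 2 / (2 * e)) = - (2 * e)^-1 * v ^+ 2).
    by field; rewrite gt_eqF.
  by field; rewrite gt_eqF.
move=> h2'.
have : fcos e 2 0 = - (c / e).
  by rewrite -(@derive_val _ _ _ _ _ _ _ h2) (@derive_val _ _ _ _ _ _ _ h2').
rewrite /fcos (_ : (fun y => _) = (fun y => -1 * gmono e 2 y)).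
  rewrite RintegralZl//; last exact: integrable_gmono.
  by rewrite /gmom mulN1r => /oppr_inj ->.
apply/funext => y; rewrite mul0r add0r (_ : 2 * (pi / 2) = pi) ?cospi//.
by field.
Qed.

End GaussianFourier.

(** * Normal laws and the characteristic function of a centered Gaussian variable *)

Section NormalLaw.
Context {R : realType}.
Local Notation mu := (@lebesgue_measure R).

(** The change of variables involves a Radon-Nikodym derivative, which is identified with
    [normal_pdf] almost everywhere because both have the same integral over every measurable set. *)
Lemma ge0_integral_normal_prob (m s : R) (f : R -> \bar R) :
  measurable_fun setT f -> (forall x, 0 <= f x)%E ->
  (\int[normal_prob m s]_x f x = \int[mu]_x (f x * (normal_pdf m s x)%:E))%E.
Proof.
move=> mf f0; have dom := @normal_prob_dominates R m s.
rewrite -(Radon_Nikodym_SigmaFinite.change_of_variables dom f0 measurableT mf).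
have iRN := Radon_Nikodym_SigmaFinite.f_integrable dom.
apply: ae_eq_integral => //.
- by apply: emeasurable_funM => //; exact: (measurable_int mu).
- apply: emeasurable_funM => //; apply/measurable_EFinP.
  exact: measurable_normal_pdf.
- apply: ae_eqe_mul2l; apply: integral_ae_eq => //.
  + by apply/measurable_EFinP; exact: measurable_normal_pdf.
  + by move=> E _ mE; rewrite -Radon_Nikodym_SigmaFinite.f_integral.
Qed.

(** Turns a Gaussian expectation into an integral against [gmono e 0], with [e] the inverse of the
    variance and the mean moved into [f], so that the moments and cosine transforms above apply.
    Positive and negative parts are treated separately. *)
Lemma integral_normal_prob (m s : R) (f : R -> R) : s != 0 ->
  let e := (s ^+ 2)^-1 in
  measurable_fun setT f ->
  mu.-integrable setT (EFin \o (fun x => f (x + m) * gmono e 0 x)) ->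
  (normal_prob m s).-integrable setT (EFin \o f) /\
  \int[normal_prob m s]_x f x =
    (Num.sqrt (2 * pi / e))^-1 * \int[mu]_x (f (x + m) * gmono e 0 x).
Proof.
move=> s0 e mf ifn.
have s20 : 0 < s ^+ 2 by rewrite exprn_even_gt0.
set c := (Num.sqrt (2 * pi / e))^-1.
have pdfE x : normal_pdf m s x = c * gmono e 0 (x - m).
  rewrite normal_pdfE// /c /normal_peak /gmono /normal_fun mul1r /e invrK.
  congr (_^-1 * expR _); last by field.
  by congr Num.sqrt; rewrite -mulr_natl; ring.
have ifp : mu.-integrable setT (EFin \o (fun x => f x * normal_pdf m s x)).
  have [+ _] := integral_shift (- m) ifn.
  move=> /(@integrable_Zl _ _ R mu c).
  rewrite (_ : (fun x => f x * normal_pdf m s x) =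
    (fun x => c * (f (x + - m + m) * gmono e 0 (x + - m)))).
    by apply.
  by apply/funext => x; rewrite pdfE /= subrK; ring.
have pdf0 x : 0 <= normal_pdf m s x by exact: normal_pdf_ge0.
have H (g : R -> R) : measurable_fun setT g -> (forall x, 0 <= g x) ->
  (\int[normal_prob m s]_x (g x)%:E = \int[mu]_x (g x * normal_pdf m s x)%:E)%E.
  move=> mg g0; rewrite ge0_integral_normal_prob//.
  exact/measurable_EFinP.
have inf : (normal_prob m s).-integrable setT (EFin \o f).
  apply/integrableP; split; first exact/measurable_EFinP.
  rewrite (_ : (\int[_]_x _ = \int[mu]_x `|(f x * normal_pdf m s x)%:E|)%E).
    by have /integrableP[] := ifp.
  rewrite (H (fun x => `|f x|))//; last exact: measurableT_comp.
  by apply: eq_integral => x _ /=; rewrite normrM (ger0_norm (pdf0 x)).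
split => //.
transitivity (\int[mu]_x (f x * normal_pdf m s x)); last first.
  rewrite -RintegralZl// -(proj2 (integral_shift m ifp)).
  by apply: eq_Rintegral => x _; rewrite pdfE addrK; ring.
congr fine; rewrite integralE [RHS]integralE; congr (_ - _)%E.
- rewrite (_ : (fun x => (f x)%:E)^\+%E = (fun x => (Num.max (f x) 0)%:E)); last first.
    by apply/funext => x; rewrite funeposE EFin_max.
  rewrite H ?measurable_maxr//; last by move=> x; rewrite le_max lexx orbT.
    apply: eq_integral => x _; rewrite funeposE -EFin_max; congr EFin.
    by rewrite maxr_pMl// mul0r.
  exact: measurable_maxr.
- rewrite (_ : (fun x => (f x)%:E)^\-%E = (fun x => (Num.max (- f x) 0)%:E)); last first.
    by apply/funext => x; rewrite funenegE EFin_max.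
  rewrite H; last by move=> x; rewrite le_max lexx orbT.
    apply: eq_integral => x _; rewrite funenegE -EFinN -EFin_max; congr EFin.
    by rewrite maxr_pMl// mul0r mulNr.
  by apply: measurable_maxr => //; exact: measurableT_comp.
Qed.

End NormalLaw.

Section GaussianRV.
Context {d : measure_display} {Omega : measurableType d} {R : realType}.
Variable P : probability Omega R.
Local Notation mu := (@lebesgue_measure R).

(** The last claim is the characteristic function in real form: the phase [th] yields the cosine and
    the sine transform at once. Since [is_gaussian] allows any mean [m], the equality [m = 0] is
    first read off the vanishing expectation. *)
Lemma centered_gaussian (Y : Omega -> R) : measurable_fun setT Y ->
  is_gaussian P Y -> ('E_P[Y] = 0)%E ->
  [/\ P.-integrable setT (EFin \o Y),
      P.-integrable setT (EFin \o (fun w => Y w ^+ 2)) &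
      forall th, \int[P]_w cos (th + Y w) =
        cos th * expR (- ((\int[P]_w (Y w ^+ 2)) / 2))].
Proof.
move=> mY [m [s [s_ge0 law]]] EY.
have mcos th : measurable_fun setT (fun x : R => cos (th + x)).
  rewrite (_ : (fun x : R => _) = (fun x : R => cos (1 * x + th))).
    exact: measurable_cos_affine.
  by apply/funext => x; rewrite mul1r addrC.
have EY' : \int[P]_w Y w = 0 by rewrite /Rintegral; move: EY; rewrite unlock => ->.
(* Degenerate case: the law is the Dirac mass at [m]. *)
have [s0|s0] := eqVneq s 0.
  have lawD (A : set R) : measurable A -> P (Y @^-1` A) = \d_m A.
    by move=> mA; rewrite law// s0 eqxx.
  have D (f : R -> R) : measurable_fun setT f ->
      P.-integrable setT (EFin \o (f \o Y)) /\ \int[P]_w f (Y w) = f m.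
    move=> mf.
    have iD : (\d_m : {measure set R -> \bar R}).-integrable setT (EFin \o f).
      apply/integrableP; split; first exact/measurable_EFinP.
      rewrite integral_dirac ?diracT ?mul1e ?ltry//.
      by do 2 apply: measurableT_comp => //.
    have [i1 ->] := law_transfer mY lawD iD; split => //.
    by rewrite /Rintegral integral_dirac ?diracT ?mul1e//; exact/measurable_EFinP.
  have [iY eY] := D idfun (@measurable_id _ _ _).
  have m0 : m = 0 by rewrite -[m]/(idfun m) -eY.
  have mX2 : measurable_fun setT (fun x : R => x ^+ 2) by exact: exprn_measurable.
  have [iY2 eY2] := D _ mX2.
  split => // th; have [_ ->] := D _ (mcos th).
  by rewrite eY2 m0 expr0n mul0r oppr0 expR0 mulr1 addr0.
have lawN (A : set R) : measurable A -> P (Y @^-1` A) = normal_prob m s A.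
  by move=> mA; rewrite law// (negbTE s0).
set e := (s ^+ 2)^-1.
have e0 : 0 < e by rewrite invr_gt0 exprn_even_gt0.
set S := Num.sqrt (2 * pi / e).
have S0 : 0 < S by rewrite sqrtr_gt0 divr_gt0// mulr_gt0// pi_gt0.
have N (f : R -> R) : measurable_fun setT f ->
    mu.-integrable setT (EFin \o (fun x => f (x + m) * gmono e 0 x)) ->
    P.-integrable setT (EFin \o (f \o Y)) /\
    \int[P]_w f (Y w) = S^-1 * \int[mu]_x (f (x + m) * gmono e 0 x).
  move=> mf ifn; have [i1 e1] := integral_normal_prob s0 mf ifn.
  by have [i2 e2] := @law_transfer _ _ Omega (measurableTypeR R) R P
    (normal_prob m s) _ _ mY lawN i1; rewrite e2 e1.
have ig k := integrable_gmono k e0.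
have E1 : (fun x => idfun (x + m) * gmono e 0 x) =
    (fun x => gmono e 1 x + m * gmono e 0 x).
  by apply/funext => x; rewrite /gmono expr1 expr0 /=; ring.
have i1 : mu.-integrable setT (EFin \o (fun x => idfun (x + m) * gmono e 0 x)).
  by rewrite E1; apply: (@integrable_D _ _ R mu) => //; exact: (@integrable_Zl _ _ R mu).
have [iY eY] := N idfun (@measurable_id _ _ _) i1.
have m0 : m = 0.
  move: eY; rewrite E1 RintegralD//; last exact: (@integrable_Zl _ _ R mu).
  rewrite RintegralZl// -[X in X + _]/(gmom e 1) gmom_odd// add0r.
  have [_ ->] := gmono0_int e0; rewrite -/S mulrCA mulVf ?gt_eqF// mulr1.
  by rewrite -[LHS]/(\int[P]_w Y w) EY'.
have mX2 : measurable_fun setT (fun x : R => x ^+ 2) by exact: exprn_measurable.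
have E2 : (fun x => (x + m) ^+ 2 * gmono e 0 x) = gmono e 2.
  by apply/funext => x; rewrite m0 /gmono; ring.
have i2 : mu.-integrable setT (EFin \o (fun x => (x + m) ^+ 2 * gmono e 0 x)).
  by rewrite E2.
have [iY2 eY2] := N _ mX2 i2.
have {}eY2 : \int[P]_w (Y w ^+ 2) = e^-1.
  rewrite eY2 E2 -[X in _ * X]/(gmom e 2) gmom2E// -/S.
  by field; rewrite !gt_eqF.
split => // th.
(* The sine part is odd and integrates to 0; the cosine part is [fcos e 0 1]. *)
have E3 : (fun x => cos (th + (x + m)) * gmono e 0 x) =
   (fun x => cos th * (cos (1 * x + 0%:R * (pi / 2)) * gmono e 0 x) +
             - sin th * (sin x * gmono e 0 x)).
  by apply/funext => x; rewrite m0 addr0 mul0r addr0 mul1r cosD; ring.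
have ic : mu.-integrable setT
    (EFin \o (fun x => cos (1 * x + 0%:R * (pi / 2)) * gmono e 0 x)).
  exact: integrable_cos_gmono.
have isn : mu.-integrable setT (EFin \o (fun x => sin x * gmono e 0 x)).
  apply: (@integrable_bdM _ _ R mu 1) => //; last by move=> x; exact: sin_max.
  by apply: continuous_measurable_fun; exact: continuous_sin.
have [|_ ->] := N _ (mcos th).
  rewrite E3; apply: (@integrable_D _ _ R mu); exact: (@integrable_Zl _ _ R mu).
rewrite E3 RintegralD//; try exact: (@integrable_Zl _ _ R mu).
rewrite !RintegralZl// -[X in cos th * X]/(fcos e 0 1) fcos0E// -/S.
rewrite (Rintegral_odd isn); last by move=> x; rewrite sinN gmonoN expr0 mul1r mulNr.
rewrite mulr0 addr0 expr1n eY2 mulrCA mulKf ?gt_eqF//.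
by congr (_ * expR (- _)); field; rewrite gt_eqF.
Qed.

End GaussianRV.

(** * Independence *)

Section Independence.
Context {d : measure_display} {Omega : measurableType d} {R : realType}.
Variable P : probability Omega R.
Implicit Types (G : set (set Omega)) (F : Omega -> R).

Lemma bounded_integrable (f : Omega -> R) (C : R) : measurable_fun setT f ->
  (forall w, `|f w| <= C) -> P.-integrable setT (EFin \o f).
Proof.
move=> mf fC; apply: (integrable_le_EFin mf fC).
exact: finite_measure_integrable_cst.
Qed.

(** Stated on preimages so that [Omega] keeps its own measurable structure while several generated
    sigma-algebras are in use; [sigma_measurableP] gives access to the closure properties of
    measurable functions. *)
Definition sigma_measurable G F : Prop :=
  forall U : set R, measurable U -> <<s G >> (F @^-1` U).

Lemma sigma_measurableP G F : sigma_measurable G F <->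
  measurable_fun (setT : set (g_sigma_algebraType G)) F.
Proof.
split=> [h _ U mU|h U mU]; first by rewrite setTI; exact: h.
by have := h measurableT U mU; rewrite setTI.
Qed.

Lemma sub_sigma_measurable G G' F : G `<=` <<s G' >> ->
  sigma_measurable G F -> sigma_measurable G' F.
Proof.
by move=> GG' h U mU; apply: (smallest_sub _ GG' (h U mU)); exact: smallest_sigma_algebra.
Qed.

Lemma sigma_sub_measurable G : G `<=` measurable -> <<s G >> `<=` measurable.
Proof. by move=> h; apply: smallest_sub => //; exact: sigma_algebra_measurable. Qed.

Lemma sigma_measurable_fun G F : G `<=` measurable -> sigma_measurable G F ->
  measurable_fun setT F.
Proof. by move=> h hF _ U mU; rewrite setTI; apply: (sigma_sub_measurable h); exact: hF. Qed.

(** For fixed [B], both sides are finite measures in [A] that agree on a pi-system containing the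
    whole space, hence on the sigma-algebra it generates. *)
Lemma indep_sigma_l G (B : set Omega) : measurable B -> G `<=` measurable ->
  setI_closed G -> G setT ->
  (forall A, G A -> P (A `&` B) = (P A * P B)%E) ->
  forall A, <<s G >> A -> P (A `&` B) = (P A * P B)%E.
Proof.
move=> mB mG IG GT h A sA.
pose r := NngNum (fine_ge0 (measure_ge0 P B)).
have rE : (r%:num%:E = P B)%E by rewrite /= fineK// fin_num_measure.
have := @g_sigma_algebra_measure_unique _ R Omega G mG (fun=> setT) (fun=> GT) _
  (mrestr P mB) (mscale r P) IG _ _ A sA.
rewrite (_ : P A * P B = mscale r P A)%E; last by rewrite /mscale rE muleC.
rewrite -[P (A `&` B)]/(mrestr P mB A); apply.
- by rewrite bigcup_const.
- by move=> C GC; apply: etrans (h _ GC) _; rewrite muleC -rE.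
- by move=> _; change (P (setT `&` B) < +oo)%E; rewrite setTI ltey_eq fin_num_measure.
Qed.

Lemma indep_sigma G1 G2 : G1 `<=` measurable -> G2 `<=` measurable ->
  setI_closed G1 -> setI_closed G2 -> G1 setT -> G2 setT ->
  (forall A B, G1 A -> G2 B -> P (A `&` B) = (P A * P B)%E) ->
  forall A B, <<s G1 >> A -> <<s G2 >> B -> P (A `&` B) = (P A * P B)%E.
Proof.
move=> m1 m2 I1 I2 T1 T2 h A B sA sB.
have mA := sigma_sub_measurable m1 sA.
rewrite setIC muleC; apply: (indep_sigma_l mA m2 I2 T2 _ sB) => {sB} {}B GB.
rewrite setIC muleC; apply: (indep_sigma_l (m2 _ GB) m1 I1 T1 _ sA) => C GC.
exact: h.
Qed.

(** The joint law agrees with the product of the two laws on rectangles, hence everywhere; the rest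
    is Fubini for the function [z.1 * z.2]. *)
Lemma indep_expectation_mul (Y Z : {RV P >-> R}) :
  (forall U V : set R, measurable U -> measurable V ->
    P (Y @^-1` U `&` Z @^-1` V) = (P (Y @^-1` U) * P (Z @^-1` V))%E) ->
  P.-integrable setT (EFin \o Y) -> P.-integrable setT (EFin \o Z) ->
  \int[P]_w (Y w * Z w) = (\int[P]_w Y w) * (\int[P]_w Z w).
Proof.
move=> ind iY iZ.
pose nY := distribution P Y; pose nZ := distribution P Z.
have mYZ : measurable_fun setT (fun w => (Y w, Z w)) by exact: measurable_fun_pair.
pose YZ : {mfun Omega >-> (R * R)%type} :=
  HB.pack (fun w => (Y w, Z w)) (isMeasurableFun.Build _ _ _ _ _ mYZ).
have law (A : set (R * R)) : measurable A ->
    P ((fun w => (Y w, Z w)) @^-1` A) = (nY \x nZ)%E A.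
  move=> mA; apply/esym.
  have H (U V : set R) : measurable U -> measurable V ->
      (distribution P YZ (U `*` V) = nY U * nZ V)%E by exact: ind.
  exact: (product_measure_unique H mA).
have mid : measurable_fun setT (EFin : R -> \bar R) by exact: EFin_measurable.
have iabs (V : {RV P >-> R}) : P.-integrable setT (EFin \o V) ->
    (\int[distribution P V]_y `|y%:E| < +oo)%E.
  move=> /integrableP[_]; apply: le_lt_trans; rewrite le_eqVlt; apply/orP; left.
  have mabs : measurable_fun setT (fun y : R => `|y%:E|%E) by exact: measurableT_comp.
  by apply/eqP; apply: (ge0_integral_distribution _ mabs).
have mf : measurable_fun setT (fun z : R * R => z.1 * z.2).
  by apply: measurable_funM; [exact: measurable_fst|exact: measurable_snd].
have mf' : measurable_fun setT (fun z : R * R => (z.1 * z.2)%:E).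
  exact/measurable_EFinP.
have iid (V : {RV P >-> R}) : P.-integrable setT (EFin \o V) ->
    (distribution P V).-integrable setT (fun y => y%:E).
  by move=> iV; apply/integrableP; split => //; exact: iabs.
have iprod : (nY \x nZ)%E.-integrable setT (fun z : R * R => (z.1 * z.2)%:E).
  apply/(integrable12ltyP _ _ mf').
  have nZn0 : (0 <= \int[nZ]_y `|y%:E|)%E by apply: integral_ge0.
  rewrite (_ : (\int[nY]_x _ = (\int[nY]_x `|x%:E|) * \int[nZ]_y `|y%:E|)%E).
    by rewrite lte_mul_pinfty ?iabs ?ge0_fin_numE ?iabs ?integral_ge0.
  rewrite -ge0_integralZr//; last exact: measurableT_comp.
  apply: eq_integral => x _; rewrite -ge0_integralZl//; last exact: measurableT_comp.
  by apply: eq_integral => y _; rewrite EFinM abseM.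
have [_ ->] := law_transfer mYZ law iprod.
rewrite /Rintegral -(integral12_prod_meas1 iprod) /fubini_F.
have eV (V : {RV P >-> R}) : P.-integrable setT (EFin \o V) ->
    (\int[distribution P V]_y y%:E)%E = (\int[P]_w V w)%:E.
  move=> iV; rewrite (integral_distribution mid iV) fineK//.
  exact: integrable_fin_num.
have secE x : (\int[nZ]_y (x * y)%:E = (x * \int[P]_w Z w)%:E)%E.
  under eq_integral do rewrite EFinM.
  by rewrite (integralZl measurableT (iid _ iZ)) eV.
transitivity (fine (\int[nY]_x (x%:E * (\int[P]_w Z w)%:E)%E)%E).
  by congr fine; apply: eq_integral => x _; rewrite -EFinM; exact: secE.
by rewrite (integralZr measurableT (iid _ iY)) eV.
Qed.

(* The product rule over the pi-systems passes to the sigma-algebras they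
   generate by splitting off one index at a time. *)
Lemma indep_prod (I : choiceType) (K : I -> set (set Omega)) (C : R)
    (F : I -> Omega -> R) (s : seq I) :
  (forall i, K i `<=` measurable) -> (forall i, setI_closed (K i)) ->
  (forall i, K i setT) ->
  (forall (s : seq I) (A : I -> set Omega), uniq s -> (forall i, K i (A i)) ->
    P (\big[setI/setT]_(i <- s) A i) = (\prod_(i <- s) P (A i))%E) ->
  (forall i, sigma_measurable (K i) (F i)) ->
  (forall i w, `|F i w| <= C) -> uniq s ->
  \int[P]_w (\prod_(i <- s) F i w) = \prod_(i <- s) \int[P]_w F i w.
Proof.
move=> mK IK TK ind sF bF.
(* The pi-system of the intersections along [s]. It contains [K i] for each [i] in [s], so the
   product of the [F i] over [s] is measurable for the sigma-algebra it generates. *)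
pose Q (s : seq I) := [set B | exists2 A : I -> set Omega,
  (forall i, K i (A i)) & B = \big[setI/setT]_(i <- s) A i].
have mQ t : Q t `<=` measurable.
  move=> _ [A KA ->]; rewrite big_seq; elim/big_ind : _ => //.
  - by move=> ? ?; exact: measurableI.
  - by move=> i _; exact: mK.
have IQ t : setI_closed (Q t).
  move=> _ _ [A KA ->] [B KB ->]; exists (fun i => A i `&` B i).
    by move=> i; exact: IK.
  by rewrite big_split.
have TQ t : Q t setT by exists (fun=> setT) => //; rewrite big1.
have KQ t i : i \in t -> K i `<=` Q t.
  move=> it B KB; exists (fun j => if j == i then B else setT).
    by move=> j; case: eqP => [->|].
  rewrite -bigcap_seq; apply/seteqP; split=> [w Bw j _|w /(_ i it)] /=.
    by case: ifP.
  by rewrite eqxx.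
have sQ t : sigma_measurable (Q t) (fun w => \prod_(i <- t) F i w).
  apply/sigma_measurableP.
  suff H t' : {subset t' <= t} -> measurable_fun
    (setT : set (g_sigma_algebraType (Q t))) (fun w => \prod_(i <- t') F i w).
    exact: H.
  elim: t' => [|i t' ih] tt.
    by under eq_fun do rewrite big_nil; exact: measurable_cst.
  under eq_fun do rewrite big_cons.
  apply: measurable_funM; last by apply: ih => j jt; apply: tt; rewrite inE jt orbT.
  apply/sigma_measurableP; apply: sub_sigma_measurable (sF i).
  apply: subset_trans (KQ t i _) _; first by apply: tt; rewrite inE eqxx.
  exact: sub_sigma_algebra.
have mP t : measurable_fun setT (fun w => \prod_(i <- t) F i w).
  by apply: sigma_measurable_fun (sQ t); exact: mQ.
have bP t w : `|\prod_(i <- t) F i w| <= C ^+ size t.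
  elim: t => [|i t ih]; first by rewrite big_nil normr1.
  by rewrite big_cons normrM exprS ler_pM.
elim: s => [_|i s ih /= /andP[ns us]].
  rewrite big_nil (_ : (fun _ => _) = cst 1).
    by rewrite Rintegral_cst// [X in fine X](_ : _ = 1%E) ?mulr1//; exact: probability_setT.
  by apply/funext => w; rewrite big_nil.
have mFi : measurable_fun setT (F i) by apply: sigma_measurable_fun (sF i); exact: mK.
pose Y : {mfun Omega >-> R} := HB.pack (F i) (isMeasurableFun.Build _ _ _ _ _ mFi).
pose Z : {mfun Omega >-> R} := HB.pack (fun w => \prod_(j <- s) F j w)
  (isMeasurableFun.Build _ _ _ _ _ (mP s)).
rewrite big_cons -ih// -(@indep_expectation_mul Y Z).
- by apply: eq_Rintegral => w _; rewrite big_cons.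
- move=> U V mU mV.
  apply: (indep_sigma (mK i) (mQ s) (IK i) (IQ s) (TK i) (TQ s)); last 2 first.
  + exact: sF.
  + exact: sQ.
  move=> A _ KA [B KB ->].
  (* Gluing [A] at [i] to [B] elsewhere changes nothing along [s], as [i] is not in [s]; the
     hypothesis can then be used on [i :: s]. *)
  pose D j := if j == i then A else B j.
  have KD j : K j (D j) by rewrite /D; case: eqP => [->|].
  have DB : \big[setI/setT]_(j <- s) B j = \big[setI/setT]_(j <- s) D j.
    by apply: eq_big_seq => j js; rewrite /D; case: eqP => // ji; rewrite -ji js in ns.
  have := ind (i :: s) D; rewrite /= ns us => /(_ isT KD).
  by rewrite !big_cons {1 3}/D eqxx DB => ->; rewrite ind.
- exact: bounded_integrable mFi (bF i).
- exact: bounded_integrable (mP s) (bP s).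
Qed.

End Independence.

(** * Derivatives of the heat kernel *)

Section HeatKernelDerivatives.
Context {R : realType}.
Variables (d : nat) (e : R).
Hypothesis e0 : 0 < e.

Definition fcos_prod (m : 'I_d -> nat) (x : 'rV[R]_d) : R :=
  (2 * pi) ^- d * \prod_i fcos e (m i) (x 0 i).

(** Fourier inversion, coordinate by coordinate: the square roots in [fcos0E] combine with
    [(2 * pi) ^- d] into the normalising constant of the kernel. *)
Lemma heat_kernelE : heat_kernel e = fcos_prod (fun=> 0%N).
Proof.
apply/funext => x; rewrite /heat_kernel /fcos_prod.
under eq_bigr do rewrite fcos0E//.
rewrite big_split/= prodr_const card_ord -expR_sum.
rewrite sumrN -mulr_suml mulNr mulrA; congr (_ * _).
have p0 : (0 : R) < 2 * pi by rewrite mulr_gt0// pi_gt0.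
have -> : (2 * pi * e) `^ (d%:R / 2) = Num.sqrt (2 * pi * e) ^+ d.
  rewrite [d%:R / 2]mulrC powRrM powR12_sqrt ?powR_mulrn ?sqrtr_ge0//.
  by rewrite ltW// mulr_gt0.
rewrite -!exprVn -exprMn; congr (_ ^+ _).
rewrite -[X in X^-1 * _](sqr_sqrtr (ltW p0)) !sqrtrM ?(ltW p0)//.
rewrite sqrtrV ?ltW//.
have s2 : Num.sqrt 2 != 0 :> R by rewrite sqrtr_eq0 -ltNge.
have sp : Num.sqrt pi != 0 :> R by rewrite sqrtr_eq0 -ltNge pi_gt0.
have se : Num.sqrt e != 0 by rewrite sqrtr_eq0 -ltNge.
by field; rewrite ?s2 ?sp ?se.
Qed.

(** Moving along the [i]-th axis affects one factor only, so the difference quotient is a constant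
    [A] times that of [fcos e (m i)]. *)
Lemma partial_fcos_prod (i : 'I_d) (m : 'I_d -> nat) :
  partial i (fcos_prod m) =
  fcos_prod (fun j => if j == i then (m j).+1 else m j).
Proof.
apply/funext => x; rewrite /partial /derive.
pose A := (2 * pi) ^- d * \prod_(j | j != i) fcos e (m j) (x 0 j).
have dfi := is_derive_fcos (x 0 i) (m i) e0.
have E (h : R) : h^-1 *: ((fcos_prod m \o shift x) (h *: delta_mx 0 i) - fcos_prod m x) =
    A * (h^-1 *: ((fcos e (m i) \o shift (x 0 i)) (h *: (1 : R)) - fcos e (m i) (x 0 i))).
  rewrite /fcos_prod /A /= (bigD1 i)//= [\prod_i0 _](bigD1 i)//=.
  rewrite !mxE !eqxx/= /GRing.scale/= !mulr1.
  rewrite (eq_bigr (fun j => fcos e (m j) (x 0 j))); first by ring.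
  by move=> j ji; rewrite !mxE (negbTE ji) andbF mulr0 add0r.
have c : A * (h^-1 *: ((fcos e (m i) \o shift (x 0 i)) (h *: (1 : R)) -
    fcos e (m i) (x 0 i))) @[h --> 0^'] --> A * fcos e (m i).+1 (x 0 i).
  apply: cvgM; first exact: cvg_cst.
  by rewrite -(@derive_val _ _ _ _ _ _ _ dfi); exact: (@ex_derive _ _ _ _ _ _ _ dfi).
rewrite (_ : (fun h : R => _) = (fun h : R => A * (h^-1 *:
  ((fcos e (m i) \o shift (x 0 i)) (h *: (1 : R)) - fcos e (m i) (x 0 i))))); last first.
  by apply/funext => h; exact: E.
rewrite (cvg_lim _ c)// /fcos_prod [in RHS](bigD1 i)//= eqxx.
rewrite [in RHS](eq_bigr (fun j => fcos e (m j) (x 0 j))); first by rewrite /A; ring.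
by move=> j /negbTE ->.
Qed.

Lemma mpartial_heat_kernel (k : 'I_d -> nat) :
  mpartial k (heat_kernel e) = fcos_prod k.
Proof.
have it n (i : 'I_d) m : iter n (partial i) (fcos_prod m) =
    fcos_prod (fun j => if j == i then (n + m j)%N else m j).
  elim: n => [|n ih] /=.
    by congr fcos_prod; apply/funext => j; case: ifP.
  rewrite ih partial_fcos_prod; congr fcos_prod; apply/funext => j.
  by case: (j == i).
rewrite /mpartial heat_kernelE.
(* Along a list without repetition each coordinate is differentiated once, to its full order, and
   the others not at all. *)
suff H s : uniq s -> foldr (fun i g => iter (k i) (partial i) g)
    (fcos_prod (fun=> 0%N)) s = fcos_prod (fun i => if i \in s then k i else 0%N).
  rewrite H ?enum_uniq//; congr fcos_prod; apply/funext => i.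
  by rewrite mem_enum.
elim: s => [//|i s ih] /= /andP[ns us].
rewrite ih// it; congr fcos_prod; apply/funext => j; rewrite inE.
by case: eqP => //= ->; rewrite (negbTE ns) addn0.
Qed.

End HeatKernelDerivatives.

(** * The Gaussian integral of a pair: parity, lower bound and closed form *)

Section GaussianPairIntegral.
Context {R : realType}.
Local Notation mu := (@lebesgue_measure R).

(* E[fcos e m Z1 * fcos e m Z2] for a centered Gaussian pair (Z1, Z2): with
   a, b, c the variances and the covariance, B = b + e, q = c / B and
   D = a + e - c^2 / B is the Schur complement. *)
Definition gpair (m : nat) (q B D : R) : R :=
  \sum_(i < m.+1) 'C(m, i)%:R * q ^+ i * gmom B (m - i) * gmom D (m + i).

(** A term survives only if [m - i] is even, and then [(-1) ^+ i = (-1) ^+ m]. *)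
Lemma gpairN m q B D : 0 < B ->
  gpair m (- q) B D = (-1) ^+ m * gpair m q B D.
Proof.
move=> B0; rewrite mulr_sumr; apply: eq_bigr => i _.
have [od|ev] := boolP (odd (m - i)); first by rewrite gmom_odd// !(mulr0, mul0r).
have im : (i <= m)%N by rewrite -ltnS.
have Es : (-1) ^+ i = (-1) ^+ m :> R.
  by rewrite -[LHS]signr_odd -[RHS]signr_odd -{2}(subnK im) oddD (negbTE ev).
by rewrite [(- q) ^+ i]exprNn Es; ring.
Qed.

(** The orders [m - i] and [m + i] have the same parity, so each term either vanishes or is a
    product of two even moments. The exponent [(2 * m).+1] of [(Num.sqrt D)^-1] is the source of the
    singularity in [rho]. *)
Lemma gpair_lb m q B D : 0 <= q -> 0 < B -> 0 < D ->
  q ^+ m * (expR (-2) * (Num.sqrt B)^-1) *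
    (expR (-2) * (Num.sqrt D)^-1 ^+ (2 * m).+1) <= gpair m q B D.
Proof.
move=> q0 B0 D0.
have ge0 i (im : (i <= m)%N) :
    0 <= 'C(m, i)%:R * q ^+ i * gmom B (m - i) * gmom D (m + i).
  have [od|ev] := boolP (odd (m - i)); first by rewrite gmom_odd// mulr0 mul0r.
  have o' : ~~ odd (m + i) by rewrite oddD -oddB.
  by rewrite !mulr_ge0 ?exprn_ge0 ?gmom_even_ge0.
(* All terms are nonnegative, and the term i = m alone gives the bound. *)
rewrite /gpair big_ord_recr/= binn subnn mul1r -[leLHS]add0r lerD//.
  by apply: sumr_ge0 => i _; apply: ge0; rewrite ltnW.
rewrite addnn -mul2n; apply: ler_pM.
- by rewrite !mulr_ge0 ?exprn_ge0 ?expR_ge0// invr_ge0 sqrtr_ge0.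
- by rewrite mulr_ge0 ?expR_ge0// exprn_ge0// invr_ge0 sqrtr_ge0.
- rewrite ler_wpM2l ?exprn_ge0//.
  by have := gmom_even_lb 0 B0; rewrite muln0 expr1.
- exact: gmom_even_lb.
Qed.

(* Complete the square in z, shift z by q y and expand the power of z - q y. *)
Lemma gpair_integral m (e a b c : R) : 0 < e -> 0 < b + e ->
  0 < a + e - c ^+ 2 / (b + e) ->
  \int[mu]_y (gmono e m y * ((-1) ^+ m * \int[mu]_z
    (gmono e m z * expR (- ((a * y ^+ 2 + 2 * c * y * z + b * z ^+ 2) / 2))))) =
  gpair m (c / (b + e)) (b + e) (a + e - c ^+ 2 / (b + e)).
Proof.
move=> e0; set B := b + e; set D := _ - _; set q := c / B => B0 D0.
(* What the completed square leaves over in [y]; together with the exponential in [gmono e m y] it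
   has precision [D]. *)
pose K y := expR (- ((a - c ^+ 2 / B) * y ^+ 2 / 2)).
pose G y z := K y * \sum_(i < m.+1) ('C(m, i)%:R * (- q * y) ^+ i) * gmono B (m - i) z.
have FG y z : gmono e m z *
    expR (- ((a * y ^+ 2 + 2 * c * y * z + b * z ^+ 2) / 2)) = G y (z + q * y).
  have -> : G y (z + q * y) = K y * gmono B 0 (z + q * y) * (z ^+ m).
    have -> : z ^+ m = ((z + q * y) + (- q * y)) ^+ m by congr (_ ^+ _); ring.
    rewrite [in RHS]exprDn /G -mulrA; congr (_ * _); rewrite mulr_sumr.
    apply: eq_bigr => i _; rewrite /gmono mul1r -mulr_natl; ring.
  rewrite /gmono expr0 mul1r -mulrA -expRD /K -expRD mulrC; congr (expR _ * _).
  by rewrite /q /B; field; rewrite gt_eqF.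
have iG y : mu.-integrable setT (EFin \o G y).
  apply: (@integrable_Zl _ _ R mu); apply: (@integrable_bigsum _ _ R mu) => i.
  by apply: (@integrable_Zl _ _ R mu); exact: integrable_gmono.
have inner y : \int[mu]_z (gmono e m z *
    expR (- ((a * y ^+ 2 + 2 * c * y * z + b * z ^+ 2) / 2))) =
    K y * \sum_(i < m.+1) ('C(m, i)%:R * (- q * y) ^+ i) * gmom B (m - i).
  under eq_Rintegral do rewrite FG.
  rewrite (proj2 (integral_shift (q * y) (iG y))) RintegralZl//; last first.
    apply: (@integrable_bigsum _ _ R mu) => i.
    by apply: (@integrable_Zl _ _ R mu); exact: integrable_gmono.
  rewrite (@Rintegral_bigsum _ _ R mu); last first.
    by move=> i; apply: (@integrable_Zl _ _ R mu); exact: integrable_gmono.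
  congr (_ * _); apply: eq_bigr => i _; rewrite RintegralZl//.
  exact: integrable_gmono.
have outer y : gmono e m y * \int[mu]_z (gmono e m z *
    expR (- ((a * y ^+ 2 + 2 * c * y * z + b * z ^+ 2) / 2))) =
    \sum_(i < m.+1) ('C(m, i)%:R * (- q) ^+ i * gmom B (m - i)) * gmono D (m + i) y.
  rewrite inner mulrA mulr_sumr; apply: eq_bigr => i _.
  rewrite /gmono -(mulrA (y ^+ m)) -expRD exprMn exprD.
  rewrite (_ : - (e * y ^+ 2 / 2) + _ = - (D * y ^+ 2 / 2)); first by ring.
  by rewrite /D; ring.
under eq_Rintegral do rewrite mulrCA outer.
rewrite RintegralZl//; last first.
  apply: (@integrable_bigsum _ _ R mu) => i.
  by apply: (@integrable_Zl _ _ R mu); exact: integrable_gmono.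
rewrite (@Rintegral_bigsum _ _ R mu); last first.
  by move=> i; apply: (@integrable_Zl _ _ R mu); exact: integrable_gmono.
(* The shift by [q * y] produced powers of [- q]; the prefactor [(-1) ^+ m] of the statement turns
   them into powers of [q]. *)
have -> : gpair m q B D = (-1) ^+ m * gpair m (- q) B D.
  by rewrite gpairN// mulrA -expr2 sqrr_sign mul1r.
congr (_ * _).
by apply: eq_bigr => i _; rewrite RintegralZl//; exact: integrable_gmono.
Qed.

End GaussianPairIntegral.

(** * Fubini's theorem under a bound by a product of integrable functions *)

Section DominatedFubini.
Context {d1 d2 : measure_display} {T1 : measurableType d1}
  {T2 : measurableType d2} {R : realType}.
Variables (m1 : {sigma_finite_measure set T1 -> \bar R})
  (m2 : {sigma_finite_measure set T2 -> \bar R}).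
Variables (f : T1 * T2 -> R) (g : T1 -> R) (h : T2 -> R).
Hypotheses (mf : measurable_fun setT f)
  (fgh : forall x y, `|f (x, y)| <= g x * h y)
  (ig : m1.-integrable setT (EFin \o g)) (ih : m2.-integrable setT (EFin \o h)).

Lemma dominated_section1 x : m2.-integrable setT (EFin \o (fun y => f (x, y))).
Proof.
apply: (@integrable_le_EFin _ _ R m2 _ (fun y => g x * h y)) => //.
  exact: (measurableT_comp mf (pair1_measurable x)).
exact: integrable_Zl.
Qed.

Lemma dominated_section2 y : m1.-integrable setT (EFin \o (fun x => f (x, y))).
Proof.
apply: (@integrable_le_EFin _ _ R m1 _ (fun x => h y * g x)).
- exact: (measurableT_comp mf (pair2_measurable y)).
- by move=> x; rewrite mulrC.
- exact: integrable_Zl.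
Qed.

(** By Tonelli, the iterated integral of [|f|] is at most the product of the integrals of [|g|] and
    [|h|]. *)
Lemma dominated_product_integrable : (m1 \x m2)%E.-integrable setT (EFin \o f).
Proof.
apply/(integrable12ltyP _ _ (f := EFin \o f)); first exact/measurable_EFinP.
have mf' : measurable_fun setT (fun z => `|(f z)%:E|%E).
  by do 2 apply: measurableT_comp => //.
have bnd x : (\int[m2]_y `|(f (x, y))%:E| <= (\int[m2]_y (`|h y|)%:E) * (`|g x|)%:E)%E.
  rewrite muleC -ge0_integralZl//=; last first.
    apply/measurable_EFinP; apply: measurableT_comp => //.
    exact: integrable_measurable ih.
  apply: ge0_le_integral => //=.
  - exact: (measurableT_comp mf' (pair1_measurable x)).
  - apply/measurable_EFinP; apply: measurable_funM => //.
    by apply: measurableT_comp => //; exact: integrable_measurable ih.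
  - move=> y _; rewrite -EFinM lee_fin (le_trans (fgh x y))//.
    by rewrite -normrM ler_norm.
apply: (@le_lt_trans _ _ (\int[m1]_x ((\int[m2]_y (`|h y|)%:E) * (`|g x|)%:E))%E).
  apply: ge0_le_integral => //=.
  - by move=> x _; exact: integral_ge0.
  - exact: (measurable_fun_fubini_tonelli_F _ mf' (fun z => abse_ge0 (f z)%:E)).
  - apply: emeasurable_funM => //; apply/measurable_EFinP; apply: measurableT_comp => //.
    exact: integrable_measurable ig.
  - by move=> x _; exact: bnd.
have hfin : (\int[m2]_y (`|h y|)%:E < +oo)%E by have /integrableP[] := ih.
have gfin : (\int[m1]_y (`|g y|)%:E < +oo)%E by have /integrableP[] := ig.
rewrite ge0_integralZl//=; last 2 first.
- apply/measurable_EFinP; apply: measurableT_comp => //.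
  exact: integrable_measurable ig.
- exact: integral_ge0.
by rewrite lte_mul_pinfty ?integral_ge0// ge0_fin_numE// integral_ge0.
Qed.

Lemma dominated_product1 :
  \int[m1]_x \int[m2]_y f (x, y) = \int[(m1 \x m2)%E]_z f z.
Proof.
rewrite /Rintegral -(integral12_prod_meas1 dominated_product_integrable).
congr fine; apply: eq_integral => x _; rewrite /fubini_F fineK//.
exact: integrable_fin_num (dominated_section1 x).
Qed.

Lemma dominated_product2 :
  \int[m2]_y \int[m1]_x f (x, y) = \int[(m1 \x m2)%E]_z f z.
Proof.
rewrite /Rintegral -(integral21_prod_meas1 dominated_product_integrable).
congr fine; apply: eq_integral => y _; rewrite /fubini_G fineK//.
exact: integrable_fin_num (dominated_section2 y).
Qed.

Lemma dominated_fubini :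
  \int[m1]_x \int[m2]_y f (x, y) = \int[m2]_y \int[m1]_x f (x, y).
Proof. by rewrite dominated_product1 dominated_product2. Qed.

Lemma dominated_integrable_F :
  m1.-integrable setT (EFin \o (fun x => \int[m2]_y f (x, y))).
Proof.
rewrite (_ : EFin \o _ = fubini_F m2 (EFin \o f)).
  exact: integrable_fubini_F dominated_product_integrable.
apply/funext => x; rewrite /fubini_F /= fineK//.
exact: integrable_fin_num (dominated_section1 x).
Qed.

Lemma dominated_measurable_G :
  measurable_fun setT (fun y => \int[m1]_x f (x, y)).
Proof.
apply/measurable_EFinP; rewrite (_ : EFin \o _ = fubini_G m1 (EFin \o f)).
  exact: measurable_fubini_G dominated_product_integrable.
apply/funext => y; rewrite /fubini_G /= fineK//.
exact: integrable_fin_num (dominated_section2 y).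
Qed.

End DominatedFubini.

(** * Expectation of a product of two kernel derivatives along a Gaussian pair *)

Section GaussianPairExpectation.
Context {d : measure_display} {Omega : measurableType d} {R : realType}.
Variable P : probability Omega R.
Local Notation mu := (@lebesgue_measure R).

Lemma measurable_fcos (e : R) m : 0 < e -> measurable_fun setT (fcos e m).
Proof.
move=> e0; apply: continuous_measurable_fun => x.
apply: differentiable_continuous; apply/derivable1_diffP.
by case: (is_derive_fcos x m e0).
Qed.

(** Exchanges the expectation with the integral that defines [fcos]. The bounded weight [g] allows
    two uses in a row: with the other [fcos] as weight, then with the remaining cosine. *)
Lemma expectation_fcos (e C : R) m (Z g : Omega -> R) : 0 < e ->
  measurable_fun setT Z -> measurable_fun setT g -> (forall w, `|g w| <= C) ->
  \int[P]_w (fcos e m (Z w) * g w) =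
  \int[mu]_y (gmono e m y * \int[P]_w (cos (Z w * y + m%:R * (pi / 2)) * g w)).
Proof.
move=> e0 mZ mg gC.
pose f (z : Omega * measurableTypeR R) :=
  cos (Z z.1 * z.2 + m%:R * (pi / 2)) * gmono e m z.2 * g z.1.
have mcos : measurable_fun setT (cos : R -> R).
  by apply: continuous_measurable_fun; exact: continuous_cos.
have mf : measurable_fun setT f.
  apply: measurable_funM; [apply: measurable_funM|].
  - apply: (measurableT_comp mcos); apply: measurable_funD => //.
    apply: measurable_funM; last exact: measurable_snd.
    exact: (measurableT_comp mZ measurable_fst).
  - exact: (measurableT_comp (measurable_gmono e m) measurable_snd).
  - exact: (measurableT_comp mg measurable_fst).
have bf w y : `|f (w, y)| <= cst C w * `|gmono e m y|.
  rewrite /f /= !normrM mulrC ler_pM//.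
  by rewrite ler_piMl// cos_max.
have iC : P.-integrable setT (EFin \o cst C) by exact: finite_measure_integrable_cst.
have ig : mu.-integrable setT (EFin \o (fun y => `|gmono e m y|)).
  by apply: integrable_norm; exact: integrable_gmono.
transitivity (\int[P]_w \int[mu]_y f (w, y)).
  apply: eq_Rintegral => w _; rewrite /fcos -RintegralZr//.
  exact: integrable_cos_gmono.
rewrite (dominated_fubini mf bf iC ig); apply: eq_Rintegral => y _.
rewrite -RintegralZl//.
  by apply: eq_Rintegral => w _; rewrite /f /=; ring.
apply: (bounded_integrable P (C := C)).
  apply: measurable_funM => //; apply: (measurableT_comp mcos).
  by apply: measurable_funD => //; exact: measurable_funM.
by move=> w; rewrite normrM (le_trans _ (gC w))// ler_piMl// cos_max.
Qed.

Lemma cos_natpi (m : nat) : cos (m%:R * pi) = (-1) ^+ m :> R.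
Proof.
elim: m => [|m ih]; first by rewrite mul0r cos0.
by rewrite -natr1 mulrDl mul1r cosDpi ih exprS mulN1r.
Qed.

(** Only the joint cosine transform of the pair is needed. After two exchanges the expectation of a
    product of cosines remains, which product-to-sum formulas reduce to that transform. *)
Lemma expectation_fcos_pair (e a b c : R) m (Z1 Z2 : Omega -> R) : 0 < e ->
  measurable_fun setT Z1 -> measurable_fun setT Z2 ->
  (forall th y z, \int[P]_w cos (th + (y * Z1 w + z * Z2 w)) =
     cos th * expR (- ((a * y ^+ 2 + 2 * c * y * z + b * z ^+ 2) / 2))) ->
  [/\ 0 < b + e, e <= a + e - c ^+ 2 / (b + e) &
      \int[P]_w (fcos e m (Z1 w) * fcos e m (Z2 w)) =
      gpair m (c / (b + e)) (b + e) (a + e - c ^+ 2 / (b + e))].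
Proof.
move=> e0 mZ1 mZ2 cf.
pose V (y z : R) := a * y ^+ 2 + 2 * c * y * z + b * z ^+ 2.
have mcos : measurable_fun setT (cos : R -> R).
  by apply: continuous_measurable_fun; exact: continuous_cos.
have mcosZ (y z th : R) : measurable_fun setT (fun w => cos (th + (y * Z1 w + z * Z2 w))).
  apply: (measurableT_comp mcos); apply: measurable_funD => //.
  by apply: measurable_funD; exact: measurable_funM.
have icosZ y z th : P.-integrable setT (EFin \o (fun w => cos (th + (y * Z1 w + z * Z2 w)))).
  by apply: (bounded_integrable P (C := 1)) => // w; exact: cos_max.
(* A cosine has expectation at most 1, so the exponent given by the case [th = 0] cannot be
   positive. *)
have V0 y z : 0 <= V y z.
  have : expR (- (V y z / 2)) <= 1.
    rewrite -[expR _]mul1r -[X in X * _]cos0 -cf.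
    rewrite (le_trans (ler_norm _))// (le_trans (Rintegral_le_norm
      (g := cst 1) (mcosZ y z 0) _ _))//.
    - by move=> w; exact: cos_max.
    - exact: finite_measure_integrable_cst.
    - by rewrite Rintegral_cst// [X in fine X](_ : _ = 1%E) ?mulr1//; exact: probability_setT.
  by rewrite -[X in _ <= X]expR0 ler_expR; lra.
have b0 : 0 <= b by have := V0 0 1; rewrite /V; lra.
have B0 : 0 < b + e by rewrite ltr_wpDl.
have D0 : e <= a + e - c ^+ 2 / (b + e).
  (* The Schur complement is the minimum of the shifted quadratic form on the line [y = 1], attained
     at this [z]. *)
  have := V0 1 (- (c / (b + e))).
  have : a + e - c ^+ 2 / (b + e) = V 1 (- (c / (b + e))) + e + e * (c / (b + e)) ^+ 2.
    by rewrite /V; field; rewrite gt_eqF.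
  move=> ->; have := mulr_ge0 (ltW e0) (sqr_ge0 (c / (b + e))); lra.
split => //.
have D1 : 0 < a + e - c ^+ 2 / (b + e) by exact: lt_le_trans e0 D0.
rewrite -(gpair_integral m e0 B0 D1).
pose phi : R := m%:R * (pi / 2).
have i2 y : mu.-integrable setT (EFin \o (fun z => gmono e m z * expR (- (V y z / 2)))).
  rewrite (_ : (fun z => _) = (fun z => expR (- (V y z / 2)) * gmono e m z)); last first.
    by apply/funext => z; rewrite mulrC.
  apply: (@integrable_bdM _ _ R mu 1); last exact: integrable_gmono.
  - apply: continuous_measurable_fun => z.
    apply: differentiable_continuous; apply/derivable1_diffP.
    have hD : is_derive z 1 (fun t : R => - (b / 2) * t ^+ 2 +
        (- (c * y) * t + - (a * y ^+ 2 / 2))) _ :=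
      is_deriveD (is_derive_quad _ z) (is_derive_affinel _ _ z).
    rewrite (_ : (fun t => _) = (fun t : R => expR (- (b / 2) * t ^+ 2 +
      (- (c * y) * t + - (a * y ^+ 2 / 2))))); first by case: (is_derive_expR_comp hD).
    by apply/funext => t; congr expR; rewrite /V; field.
  - move=> z; rewrite ger0_norm ?expR_ge0// -[X in _ <= X]expR0 ler_expR.
    by have := V0 y z; lra.
pose cst_m : R := \int[mu]_y `|gmono e m y|.
rewrite (expectation_fcos m e0 mZ1 (C := cst_m)); last 2 first.
- exact: (measurableT_comp (measurable_fcos m e0) mZ2).
- by move=> w; exact: fcos_bounded.
apply: eq_Rintegral => y _; congr (_ * _).
transitivity (\int[P]_w (fcos e m (Z2 w) * cos (Z1 w * y + phi))).
  by apply: eq_Rintegral => w _; rewrite mulrC.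
rewrite (expectation_fcos m e0 mZ2 (C := 1)); last 2 first.
- apply: (measurableT_comp mcos); apply: measurable_funD => //.
  exact: measurable_funM.
- by move=> w; exact: cos_max.
(* The two phases [phi] add up to [m * pi], which gives the sign, and cancel in the difference. *)
have E z : \int[P]_w (cos (Z2 w * z + phi) * cos (Z1 w * y + phi)) =
    2^-1 * ((-1) ^+ m * expR (- (V y z / 2))) + 2^-1 * expR (- (V y (- z) / 2)).
  transitivity (\int[P]_w (2^-1 * cos (m%:R * pi + (y * Z1 w + z * Z2 w)) +
      2^-1 * cos (0 + (y * Z1 w + - z * Z2 w)))).
    apply: eq_Rintegral => w _.
    rewrite (_ : m%:R * pi + _ = (Z1 w * y + phi) + (Z2 w * z + phi)); last first.
      by rewrite /phi; field.
    rewrite (_ : 0 + _ = (Z1 w * y + phi) - (Z2 w * z + phi)); last by ring.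
    move: (Z1 w * y + phi) (Z2 w * z + phi) => u v.
    by rewrite cosD cosB; field.
  rewrite RintegralD//; try exact: integrable_Zl.
  by rewrite !RintegralZl// !cf cos_natpi cos0 mul1r.
under eq_Rintegral do rewrite E mulrDr !(mulrCA _ 2^-1).
have iN : mu.-integrable setT (EFin \o (fun z => gmono e m z * expR (- (V y (- z) / 2)))).
  have [+ _] := integral_opp (i2 y).
  move=> /(@integrable_Zl _ _ R mu ((-1) ^+ m)).
  rewrite (_ : (fun x => (-1) ^+ m * _) = (fun z => gmono e m z * expR (- (V y (- z) / 2)))).
    by apply.
  apply/funext => z; rewrite /= gmonoN [LHS]mulrA [(-1) ^+ m * (_ * _)]mulrA.
  by rewrite -signr_odd -expr2 sqrr_sign mul1r.
have iC : mu.-integrable setT (EFin \o (fun z => (-1) ^+ m * (gmono e m z * expR (- (V y z / 2))))).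
  exact: (@integrable_Zl _ _ R mu).
under eq_Rintegral do rewrite (mulrCA _ ((-1) ^+ m)).
rewrite RintegralD//; try exact: (@integrable_Zl _ _ R mu).
rewrite !RintegralZl//.
(* Reflecting [z] in the second half costs a factor [(-1) ^+ m] through [gmono] and makes the two
   halves equal. *)
rewrite -[X in _ + _ * X](proj2 (integral_opp iN)).
have -> : \int[mu]_z (gmono e m (- z) * expR (- (V y (- - z) / 2))) =
    (-1) ^+ m * \int[mu]_z (gmono e m z * expR (- (V y z / 2))).
  rewrite -RintegralZl//; apply: eq_Rintegral => z _.
  by rewrite gmonoN opprK mulrA.
by rewrite -mulrDl -[RHS]mul1r; congr (_ * _); field.
Qed.

End GaussianPairExpectation.

(** * Gaussian processes *)

Section ProcessCovariance.
Context {dO : measure_display} {Omega : measurableType dO} {R : realType}.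
Variable P : probability Omega R.
Variable d : nat.
Implicit Types X : 'I_d -> R -> {RV P >-> R}.

Definition rcov X l t s : R := \int[P]_w (X l t w * X l s w).

Lemma expectation_Rintegral (f : Omega -> R) : P.-integrable setT (EFin \o f) ->
  ('E_P[f])%E = (\int[P]_w f w)%:E.
Proof.
by move=> fi; rewrite unlock fineK//; exact: integrable_fin_num fi.
Qed.

Lemma rcovC X l t s : rcov X l t s = rcov X l s t.
Proof. by apply: eq_Rintegral => w _; rewrite mulrC. Qed.

Lemma gaussian_pair X l t s y z : gaussian_process X -> 0 <= t -> 0 <= s ->
  is_gaussian P (fun w => y * X l t w + z * X l s w).
Proof.
move=> gX t0 s0.
have := gX 2%N (fun=> l) (fun j => if j == ord0 then t else s)
  (fun j => if j == ord0 then y else z).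
rewrite (_ : (fun w => \sum_(j < 2) _) = (fun w => y * X l t w + z * X l s w)).
  by apply=> j; case: ifP.
by apply/funext => w; rewrite !big_ord_recl big_ord0/= addr0.
Qed.

Lemma gaussian_square_integrable X l t : gaussian_process X -> centered X ->
  0 <= t -> P.-integrable setT (EFin \o X l t) /\
    P.-integrable setT (EFin \o (fun w => X l t w ^+ 2)).
Proof.
move=> gX cX t0; have := @gaussian_pair X l t t 1 0 gX t0 t0.
rewrite (_ : (fun w => _) = (X l t : Omega -> R)); last first.
  by apply/funext => w; rewrite mul1r mul0r addr0.
by move=> h; have [] := centered_gaussian (measurable_funP (X l t)) h (cX l t t0).
Qed.

Lemma integrable_cov X l t s : gaussian_process X -> centered X ->
  0 <= t -> 0 <= s -> P.-integrable setT (EFin \o (fun w => X l t w * X l s w)).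
Proof.
move=> gX cX t0 s0.
have [_ it] := gaussian_square_integrable l gX cX t0.
have [_ is2] := gaussian_square_integrable l gX cX s0.
apply: (integrable_le_EFin (g := fun w => X l t w ^+ 2 + X l s w ^+ 2)).
- exact: measurable_funM.
- move=> w; rewrite normrM -(real_normK (num_real (X l t w))) -(real_normK (num_real (X l s w))).
  have := sqr_ge0 (`|X l t w| - `|X l s w|).
  have := normr_ge0 (X l t w); have := normr_ge0 (X l s w); nra.
- exact: integrable_D.
Qed.

Lemma pair_second_moment X l t s y z : gaussian_process X -> centered X ->
  0 <= t -> 0 <= s ->
  \int[P]_w ((y * X l t w + z * X l s w) ^+ 2) =
  rcov X l t t * y ^+ 2 + 2 * rcov X l t s * y * z + rcov X l s s * z ^+ 2.
Proof.
move=> gX cX t0 s0.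
have [_ it2] := gaussian_square_integrable l gX cX t0.
have [_ is2] := gaussian_square_integrable l gX cX s0.
have its := integrable_cov l gX cX t0 s0.
transitivity (\int[P]_w ((y ^+ 2 * X l t w ^+ 2 + (2 * y * z) * (X l t w * X l s w)) +
    z ^+ 2 * X l s w ^+ 2)).
  by apply: eq_Rintegral => w _; ring.
rewrite RintegralD//; [|apply: integrable_D; exact: integrable_Zl|exact: integrable_Zl].
rewrite RintegralD//; try exact: integrable_Zl.
rewrite !RintegralZl// -/(rcov X l t s).
rewrite (_ : \int[P]_w X l t w ^+ 2 = rcov X l t t); last exact: eq_Rintegral.
rewrite (_ : \int[P]_w X l s w ^+ 2 = rcov X l s s); last exact: eq_Rintegral.
by ring.
Qed.

Lemma rcov_quad_ge0 X l t s y z : gaussian_process X -> centered X ->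
  0 <= t -> 0 <= s ->
  0 <= rcov X l t t * y ^+ 2 + 2 * rcov X l t s * y * z + rcov X l s s * z ^+ 2.
Proof.
move=> gX cX t0 s0; rewrite -pair_second_moment//.
by apply: Rintegral_ge0 => w _; exact: sqr_ge0.
Qed.

Lemma gaussian_pair_cos X l t s y z : gaussian_process X -> centered X ->
  0 <= t -> 0 <= s -> forall th,
  \int[P]_w cos (th + (y * X l t w + z * X l s w)) = cos th *
    expR (- ((rcov X l t t * y ^+ 2 + 2 * rcov X l t s * y * z + rcov X l s s * z ^+ 2) / 2)).
Proof.
move=> gX cX t0 s0 th.
have [it it2] := gaussian_square_integrable l gX cX t0.
have [is1 is2] := gaussian_square_integrable l gX cX s0.
have g := gaussian_pair l y z gX t0 s0.
have mA : measurable_fun setT (fun w => y * X l t w + z * X l s w).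
  by apply: measurable_funD; exact: measurable_funM.
have E0 u : 0 <= u -> P.-integrable setT (EFin \o X l u) -> \int[P]_w X l u w = 0.
  by move=> u0 iu; have := cX l u u0; rewrite expectation_Rintegral// => -[].
have EA : ('E_P[fun w => (y * X l t w + z * X l s w)%R] = 0)%E.
  rewrite expectation_Rintegral; last by apply: integrable_D; exact: integrable_Zl.
  rewrite RintegralD//; try exact: integrable_Zl.
  by rewrite !RintegralZl// !E0// !mulr0 addr0.
have [_ _ ->] := centered_gaussian mA g EA.
by rewrite pair_second_moment.
Qed.

Lemma increment_cov X l t s : gaussian_process X -> centered X ->
  0 <= t -> 0 <= s ->
  ('E_P[fun w => ((X l t w - X l s w) ^+ 2)%R])%E =
  (rcov X l t t + rcov X l s s - 2 * rcov X l t s)%:E.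
Proof.
move=> gX cX t0 s0.
have [it it2] := gaussian_square_integrable l gX cX t0.
have [is1 is2] := gaussian_square_integrable l gX cX s0.
have its := integrable_cov l gX cX t0 s0.
have E : (fun w => (X l t w - X l s w) ^+ 2) =
    (fun w => (1 * X l t w + -1 * X l s w) ^+ 2).
  by apply/funext => w; ring.
rewrite E expectation_Rintegral ?pair_second_moment//; first by congr EFin; ring.
have {}E : (fun w => (1 * X l t w + -1 * X l s w) ^+ 2) =
    (fun w => (X l t w ^+ 2 + X l s w ^+ 2) + -2 * (X l t w * X l s w)).
  by apply/funext => w; ring.
rewrite E; apply: integrable_D; last exact: integrable_Zl.
exact: integrable_D.
Qed.

(** For measurable [A], the paths [f] with [A (f t * f s)] form an event of the path sigma-algebra,
    so the products of the values at [t] and [s] have the same law for both components. *)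
Lemma rcov_same_law X l l' t s : gaussian_process X -> centered X ->
  components_identically_distributed X -> 0 <= t -> 0 <= s ->
  rcov X l t s = rcov X l' t s.
Proof.
move=> gX cX iX t0 s0.
have i1 := integrable_cov l gX cX t0 s0.
have i2 := integrable_cov l' gX cX t0 s0.
have mX j : measurable_fun setT (fun w => X j t w * X j s w) by exact: measurable_funM.
pose Y' : {mfun Omega >-> R} := HB.pack (fun w => X l' t w * X l' s w)
  (isMeasurableFun.Build _ _ _ _ _ (mX l')).
have ii : (distribution P Y').-integrable setT (EFin \o idfun).
  exact: (integrable_pushforward (mX l') (f := EFin)).
have law1 (A : set R) : measurable A ->
    P ((fun w => X l t w * X l s w) @^-1` A) = distribution P Y' A.
  move=> mA.
  pose G : set (set (R -> R)) := \bigcup_(u in [set u : R | 0 <= u])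
    preimage_set_system setT (fun f : R -> R => f u) measurable.
  apply: (iX l l' [set f : R -> R | A (f t * f s)]).
  have me u : 0 <= u -> measurable_fun (setT : set (g_sigma_algebraType G))
      (fun f : R -> R => f u).
    move=> u0 _ U mU; apply: sub_sigma_algebra; exists u => //.
    by exists U.
  have := measurable_funM (me t t0) (me s s0).
  by move=> /(_ measurableT A mA); rewrite setTI.
have [_ E1] := law_transfer (mX l) law1 ii.
have law2 (A : set R) : measurable A ->
    P ((fun w => X l' t w * X l' s w) @^-1` A) = distribution P Y' A by [].
have [_ E2] := law_transfer (mX l') law2 ii.
by rewrite /rcov; move: E1 E2; rewrite /= => -> ->.
Qed.

End ProcessCovariance.

(** * Factorisation over the two processes and over the coordinates *)

Section ProcessIndependence.
Context {dO : measure_display} {Omega : measurableType dO} {R : realType}.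
Variable P : probability Omega R.

Lemma indep_bounded_mul (G1 G2 : set (set Omega)) (F1 F2 : Omega -> R) (C1 C2 : R) :
  G1 `<=` measurable -> G2 `<=` measurable ->
  (forall A B, <<s G1 >> A -> <<s G2 >> B -> P (A `&` B) = (P A * P B)%E) ->
  sigma_measurable G1 F1 -> sigma_measurable G2 F2 ->
  (forall w, `|F1 w| <= C1) -> (forall w, `|F2 w| <= C2) ->
  \int[P]_w (F1 w * F2 w) = (\int[P]_w F1 w) * (\int[P]_w F2 w).
Proof.
move=> m1 m2 ind s1 s2 b1 b2.
have mF1 := sigma_measurable_fun m1 s1.
have mF2 := sigma_measurable_fun m2 s2.
pose Y : {mfun Omega >-> R} := HB.pack F1 (isMeasurableFun.Build _ _ _ _ _ mF1).
pose Z : {mfun Omega >-> R} := HB.pack F2 (isMeasurableFun.Build _ _ _ _ _ mF2).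
apply: (@indep_expectation_mul _ _ _ P Y Z).
- by move=> U V mU mV; apply: ind; [exact: s1|exact: s2].
- exact: bounded_integrable mF1 b1.
- exact: bounded_integrable mF2 b2.
Qed.

Variable d : nat.
Implicit Types X Y : 'I_d -> R -> {RV P >-> R}.

(** The generating class inside [sigma_process], named so that [sigma_measurable] can refer to it;
    [gen_comp] does the same for [sigma_comp]. *)
Definition gen_process X : set (set Omega) :=
  \bigcup_(i in [set i : 'I_d * R | 0 <= i.2])
    preimage_set_system setT (X i.1 i.2 : Omega -> R) measurable.

Definition gen_comp X l : set (set Omega) :=
  \bigcup_(t in [set t : R | 0 <= t])
    preimage_set_system setT (X l t : Omega -> R) measurable.

Lemma gen_process_measurable X : gen_process X `<=` measurable.
Proof.
move=> _ [[l t] _ [U mU <-]]; exact: (measurable_funP (X l t)).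
Qed.

Lemma gen_comp_measurable X l : gen_comp X l `<=` measurable.
Proof. by move=> _ [t _ [U mU <-]]; exact: (measurable_funP (X l t)). Qed.

Lemma gen_comp_process X l : gen_comp X l `<=` gen_process X.
Proof. by move=> A [t t0 hA]; exists (l, t). Qed.

Lemma sigma_comp_process X l : sigma_comp X l `<=` sigma_process X.
Proof.
apply: smallest_sub; first exact: smallest_sigma_algebra.
exact: subset_trans (@gen_comp_process X l) (@sub_sigma_algebra _ _ _).
Qed.

Lemma gen_comp_RV X l t : 0 <= t -> sigma_measurable (gen_comp X l) (X l t).
Proof.
move=> t0 U mU; apply: sub_sigma_algebra; exists t => //.
by exists U => //; rewrite setTI.
Qed.

Lemma gen_process_RV X l t : 0 <= t -> sigma_measurable (gen_process X) (X l t).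
Proof.
move=> t0; apply: (sub_sigma_measurable (G := gen_comp X l)); last exact: gen_comp_RV.
by apply: subset_trans (@gen_comp_process X l) _; exact: sub_sigma_algebra.
Qed.

(** Expanding the cosine of the difference separates the [X] part [A] from the [Y] part [B]. The
    product of sines has expectation 0 because both processes are centered, and in the product of
    cosines the exponents, hence the covariances, add up. *)
Lemma independent_pair_cos X Y l t1 t2 s1 s2 :
  gaussian_process X -> centered X -> gaussian_process Y -> centered Y ->
  independent_processes X Y -> 0 <= t1 -> 0 <= t2 -> 0 <= s1 -> 0 <= s2 ->
  forall th y z,
  \int[P]_w cos (th + (y * (X l t1 w - Y l s1 w) + z * (X l t2 w - Y l s2 w))) =
  cos th * expR (- (((rcov X l t1 t1 + rcov Y l s1 s1) * y ^+ 2 +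
    2 * (rcov X l t1 t2 + rcov Y l s1 s2) * y * z +
    (rcov X l t2 t2 + rcov Y l s2 s2) * z ^+ 2) / 2)).
Proof.
move=> gX cX gY cY ind t10 t20 s10 s20 th y z.
have mcos : measurable_fun setT (cos : R -> R).
  by apply: continuous_measurable_fun; exact: continuous_cos.
pose A w := y * X l t1 w + z * X l t2 w.
pose B w := y * Y l s1 w + z * Y l s2 w.
have sA c : sigma_measurable (gen_process X) (fun w => cos (c + A w)).
  apply/sigma_measurableP; apply: (measurableT_comp mcos).
  by apply: measurable_funD => //; apply: measurable_funD; apply: measurable_funM => //;
    apply/sigma_measurableP; exact: gen_process_RV.
have sB c : sigma_measurable (gen_process Y) (fun w => cos (c + B w)).
  apply/sigma_measurableP; apply: (measurableT_comp mcos).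
  by apply: measurable_funD => //; apply: measurable_funD; apply: measurable_funM => //;
    apply/sigma_measurableP; exact: gen_process_RV.
have H c c' : \int[P]_w (cos (c + A w) * cos (c' + B w)) =
    (\int[P]_w cos (c + A w)) * (\int[P]_w cos (c' + B w)).
  apply: (indep_bounded_mul (C1 := 1) (C2 := 1)
    (@gen_process_measurable X) (@gen_process_measurable Y) ind (sA c) (sB c')).
  - by move=> w; exact: cos_max.
  - by move=> w; exact: cos_max.
have i c c' : P.-integrable setT (EFin \o (fun w => cos (c + A w) * cos (c' + B w))).
  apply: (@bounded_integrable _ _ _ P _ 1).
    apply: measurable_funM.
      exact: sigma_measurable_fun (@gen_process_measurable X) (sA c).
    exact: sigma_measurable_fun (@gen_process_measurable Y) (sB c').
  by move=> w; rewrite normrM mulr_ile1// cos_max.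
(* Sines are written as cosines with phase lowered by [pi / 2], so that [gaussian_pair_cos] applies
   to every factor; the last one then carries [cos (- (pi / 2)) = 0]. *)
transitivity (\int[P]_w (cos (th + A w) * cos (0 + B w) +
    cos (th - pi / 2 + A w) * cos (- (pi / 2) + B w))).
  apply: eq_Rintegral => w _.
  rewrite (_ : th + _ = (th + A w) - B w); last by rewrite /A /B; ring.
  rewrite cosB add0r; congr (_ + _ * _).
    by rewrite (_ : th - pi / 2 + A w = th + A w - pi / 2) ?cosBpihalf//; ring.
  by rewrite addrC cosBpihalf.
rewrite RintegralD// !H !gaussian_pair_cos//.
rewrite cosN cos_pihalf cos0 !mul0r mulr0 addr0 mul1r -[LHS]mulrA -expRD.
by congr (_ * expR _); ring.
Qed.

(** The coordinates of the pair of processes are independent, so the expectation factors; identical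
    distribution then lets every factor use the covariances of the single component [l0]. *)
Lemma components_fcos_expectation X Y (e : R) (k : 'I_d -> nat) (l0 : 'I_d) t1 t2 s1 s2 :
  0 < e ->
  gaussian_process X -> centered X -> components_independent X ->
  components_identically_distributed X ->
  gaussian_process Y -> centered Y -> components_independent Y ->
  components_identically_distributed Y ->
  independent_processes X Y -> 0 <= t1 -> 0 <= t2 -> 0 <= s1 -> 0 <= s2 ->
  let a := rcov X l0 t1 t1 + rcov Y l0 s1 s1 in
  let b := rcov X l0 t2 t2 + rcov Y l0 s2 s2 in
  let c := rcov X l0 t1 t2 + rcov Y l0 s1 s2 in
  [/\ 0 < b + e, e <= a + e - c ^+ 2 / (b + e) &
  \int[P]_w (\prod_l (fcos e (k l) (X l t1 w - Y l s1 w) *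
                      fcos e (k l) (X l t2 w - Y l s2 w))) =
  \prod_l gpair (k l) (c / (b + e)) (b + e) (a + e - c ^+ 2 / (b + e))].
Proof.
move=> e0 gX cX indX idX gY cY indY idY ind t10 t20 s10 s20 a b c.
have pair l := expectation_fcos_pair (k l) e0
  (measurable_funB (measurable_funP (X l t1)) (measurable_funP (Y l s1)))
  (measurable_funB (measurable_funP (X l t2)) (measurable_funP (Y l s2)))
  (@independent_pair_cos X Y l t1 t2 s1 s2 gX cX gY cY ind t10 t20 s10 s20).
have [B0 D0 _] := pair l0; split => //.
(* A pi-system for the [l]-th components of both processes jointly: independence of the processes
   splits [A] from [B], independence of the components splits the indices. *)
pose K l := [set C | exists A B, [/\ sigma_comp X l A, sigma_comp Y l B & C = A `&` B]].
pose F l w := fcos e (k l) (X l t1 w - Y l s1 w) * fcos e (k l) (X l t2 w - Y l s2 w).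
pose M l : R := \int[lebesgue_measure]_y `|gmono e (k l) y|.
have M0 l : 0 <= M l by apply: Rintegral_ge0.
(* One bound valid for all coordinates, as [indep_prod] requires. *)
pose C : R := \sum_l (M l ^+ 2).
have mcX l : sigma_comp X l `<=` measurable.
  by apply: sigma_sub_measurable; exact: gen_comp_measurable.
have mcY l : sigma_comp Y l `<=` measurable.
  by apply: sigma_sub_measurable; exact: gen_comp_measurable.
have sT (G : set (set Omega)) : <<s G >> setT by exact: (@measurableT _ (g_sigma_algebraType G)).
have sI (G : set (set Omega)) : setI_closed <<s G >>.
  by move=> A B; exact: (@measurableI _ (g_sigma_algebraType G)).
have -> : \prod_l gpair (k l) (c / (b + e)) (b + e) (a + e - c ^+ 2 / (b + e)) =
    \prod_l \int[P]_w F l w.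
  apply: eq_bigr => l _; have [_ _ E] := pair l.
  have rX t s : 0 <= t -> 0 <= s -> rcov X l t s = rcov X l0 t s.
    by move=> t0 s0; exact: rcov_same_law.
  have rY t s : 0 <= t -> 0 <= s -> rcov Y l t s = rcov Y l0 t s.
    by move=> t0 s0; exact: rcov_same_law.
  rewrite (rX _ _ t10 t10) (rX _ _ t20 t20) (rX _ _ t10 t20) in E.
  rewrite (rY _ _ s10 s10) (rY _ _ s20 s20) (rY _ _ s10 s20) in E.
  exact: esym E.
rewrite -[in RHS]big_enum -(@indep_prod _ _ _ P _ K C F (enum 'I_d)) ?enum_uniq//.
- by apply: eq_Rintegral => w _; rewrite -[in LHS]big_enum.
- move=> l _ [A [B [sA sB ->]]]; apply: measurableI; [exact: mcX sA|exact: mcY sB].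
- move=> l _ _ [A [B [sA sB ->]]] [A' [B' [sA' sB' ->]]].
  exists (A `&` A'), (B `&` B'); split; [exact: sI|exact: sI|].
  by rewrite setIACA.
- by move=> l; exists setT, setT; split; [exact: sT|exact: sT|rewrite setTI].
- move=> s D us KD.
  have /choice[A /choice[B AB]] := KD.
  have sA l : sigma_comp X l (A l) by have [] := AB l.
  have sB l : sigma_comp Y l (B l) by have [] := AB l.
  have DE l : D l = A l `&` B l by have [] := AB l.
  have prodE (Z : 'I_d -> R -> {RV P >-> R}) (E : 'I_d -> set Omega) :
      components_independent Z -> (forall l, sigma_comp Z l (E l)) ->
      P (\big[setI/setT]_(l <- s) E l) = (\prod_(l <- s) P (E l))%E.
    move=> indZ sE.
    have eqS : [set` [set l in s]%SET] = [set` s].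
      by apply/seteqP; split=> l /=; rewrite inE.
    rewrite -bigcap_seq -eqS indZ// big_uniq//=.
    by apply: eq_bigl => l; rewrite inE.
  have spE (Z : 'I_d -> R -> {RV P >-> R}) (E : 'I_d -> set Omega) :
      (forall l, sigma_comp Z l (E l)) -> sigma_process Z (\big[setI/setT]_(l <- s) E l).
    move=> sE; elim/big_ind : _ => [|U V|l _]; [exact: sT|exact: sI|].
    exact: (@sigma_comp_process Z l).
  under eq_bigr do rewrite DE.
  rewrite big_split/= ind; [|exact: spE..].
  rewrite (prodE X)// (prodE Y)//.
  rewrite -big_split/=; apply: eq_bigr => l _; rewrite DE ind//.
  - exact: (@sigma_comp_process X l).
  - exact: (@sigma_comp_process Y l).
- move=> l.
  have sX t : 0 <= t -> measurable_fun (setT : set (g_sigma_algebraType (K l))) (X l t).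
    move=> t0; apply/sigma_measurableP => U mU; apply: sub_sigma_algebra.
    exists (X l t @^-1` U), setT; split; [exact: gen_comp_RV|exact: sT|by rewrite setIT].
  have sY t : 0 <= t -> measurable_fun (setT : set (g_sigma_algebraType (K l))) (Y l t).
    move=> t0; apply/sigma_measurableP => U mU; apply: sub_sigma_algebra.
    exists setT, (Y l t @^-1` U); split; [exact: sT|exact: gen_comp_RV|by rewrite setTI].
  apply/sigma_measurableP; apply: measurable_funM;
    apply: (measurableT_comp (measurable_fcos (k l) e0));
    by apply: measurable_funB; [exact: sX|exact: sY].
- move=> l w; rewrite /F normrM.
  apply: (@le_trans _ _ (M l ^+ 2)).
    by rewrite expr2 ler_pM// fcos_bounded.
  by rewrite /C (bigD1 l)//= lerDl sumr_ge0// => j _; rewrite sqr_ge0.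
Qed.

End ProcessIndependence.

(** * Second moment of the local time *)

Section SecondMoment.
Context {d1 d2 : measure_display} {Q : measurableType d1}
  {Omega : measurableType d2} {R : realType}.
Variables (m : {sigma_finite_measure set Q -> \bar R}) (P : probability Omega R).
Variables (F : Q * Omega -> R) (g : Q -> R).
Hypotheses (mF : measurable_fun setT F) (Fg : forall q w, `|F (q, w)| <= g q)
  (ig : m.-integrable setT (EFin \o g)).

Let L w := \int[m]_q F (q, w).
Let C := \int[m]_q g q.

Let mFq q : measurable_fun setT (fun w => F (q, w)).
Proof. exact: (measurableT_comp mF (pair1_measurable q)). Qed.

Let mFw w : measurable_fun setT (fun q => F (q, w)).
Proof. exact: (measurableT_comp mF (pair2_measurable w)). Qed.

Let LC w : `|L w| <= C.
Proof. exact: Rintegral_le_norm. Qed.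

Let icst (c : R) : P.-integrable setT (EFin \o cst c).
Proof. exact: finite_measure_integrable_cst. Qed.

Let mL : measurable_fun setT L.
Proof.
apply: (dominated_measurable_G (m1 := m) (m2 := P) mF _ ig (icst 1)).
by move=> q w; rewrite mulr1.
Qed.

Let f1 (z : Q * Omega) := F z * L z.2.

Let mf1 : measurable_fun setT f1.
Proof. by apply: measurable_funM => //; exact: (measurableT_comp mL measurable_snd). Qed.

Let bf1 q w : `|f1 (q, w)| <= g q * cst C w.
Proof. by rewrite /f1 normrM ler_pM. Qed.

Let inner q : \int[P]_w f1 (q, w) = \int[m]_q' \int[P]_w (F (q, w) * F (q', w)).
Proof.
pose f2 (z : Q * Omega) := F (q, z.2) * F z.
have mf2 : measurable_fun setT f2.
  by apply: measurable_funM => //; exact: (measurableT_comp (mFq q) measurable_snd).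
have bf2 q' w : `|f2 (q', w)| <= g q' * cst (g q) w.
  by rewrite /f2 normrM mulrC ler_pM.
rewrite (dominated_fubini mf2 bf2 ig (icst (g q))).
apply: eq_Rintegral => w _; rewrite /f1 -RintegralZl//.
exact: integrable_le_EFin (mFw w) (Fg ^~ w) ig.
Qed.

(** The square is expanded one copy of [L] at a time. In [f1] the other copy is merely a bounded
    factor, so both exchanges take place on [Q * Omega]. *)
Lemma second_moment : \int[P]_w (L w ^+ 2) =
  \int[m]_q \int[m]_q' \int[P]_w (F (q, w) * F (q', w)).
Proof.
transitivity (\int[P]_w \int[m]_q f1 (q, w)).
  apply: eq_Rintegral => w _; rewrite /f1 /= RintegralZr ?expr2//.
  exact: integrable_le_EFin (mFw w) (Fg ^~ w) ig.
rewrite -(dominated_fubini mf1 bf1 ig (icst C)).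
by apply: eq_Rintegral => q _; exact: inner.
Qed.

Lemma second_moment_integrable :
  P.-integrable setT (EFin \o (fun w => L w ^+ 2)).
Proof.
apply: (@bounded_integrable _ _ R P _ (C ^+ 2)).
  exact: measurable_funX.
by move=> w; rewrite normrX lerXn2r ?nnegrE// (le_trans _ (LC w)).
Qed.

Lemma second_moment_integrable1 : m.-integrable setT
  (EFin \o (fun q => \int[m]_q' \int[P]_w (F (q, w) * F (q', w)))).
Proof.
rewrite (_ : (fun q => _) = (fun q => \int[P]_w f1 (q, w))).
  exact: (dominated_integrable_F mf1 bf1 ig (icst C)).
by apply/funext => q; rewrite inner.
Qed.

Lemma second_moment_integrable2 q : m.-integrable setT
  (EFin \o (fun q' => \int[P]_w (F (q, w) * F (q', w)))).
Proof.
pose f2 (z : Q * Omega) := F (q, z.2) * F z.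
have mf2 : measurable_fun setT f2.
  by apply: measurable_funM => //; exact: (measurableT_comp (mFq q) measurable_snd).
have bf2 q' w : `|f2 (q', w)| <= g q' * cst (g q) w.
  by rewrite /f2 normrM mulrC ler_pM.
exact: (dominated_integrable_F mf2 bf2 ig (icst (g q))).
Qed.

End SecondMoment.

Section JointMeasurability.
Context {d : measure_display} {Omega : measurableType d} {R : realType}.

(* The max only serves to avoid the junk values at negative times. *)
Lemma measurable_continuous_paths (x : R -> Omega -> R) :
  (forall t, 0 <= t -> measurable_fun setT (x t)) ->
  (forall w, {within `[0, +oo[, continuous (fun t => x t w)}) ->
  measurable_fun (setT : set (R * Omega)) (fun z => x (Num.max 0 z.1) z.2).
Proof.
move=> mx cx.
(* Rounding down to the grid of mesh [1 / n.+1]: the process along [u n] is constant in time on each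
   cell, hence jointly measurable, and converges by continuity. *)
pose u n (t : R) : R := (Num.truncn (Num.max 0 t * n.+1%:R))%:R / n.+1%:R.
have u0 n t : 0 <= u n t by rewrite divr_ge0.
have m0 (t : R) : 0 <= Num.max 0 t by rewrite le_max lexx.
apply: (@measurable_fun_cvg _ _ _ _ (fun n z => x (u n z.1) z.2)).
  move=> n _ U mU; rewrite setTI.
  pose I k := (fun t : R => Num.max 0 t * n.+1%:R) @^-1` `[k%:R, k.+1%:R[.
  rewrite (_ : _ @^-1` U = \bigcup_k (I k `*` (x (k%:R / n.+1%:R) @^-1` U))).
    apply: bigcupT_measurable => k; apply: measurableX.
      rewrite -[I k]setTI.
      have : measurable_fun setT (fun t : R => Num.max 0 t * n.+1%:R).
        by apply: measurable_funM => //; exact: measurable_maxr.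
      by apply => //; exact: measurable_itv.
    by rewrite -[X in measurable X]setTI; apply: mx => //; rewrite divr_ge0.
  apply/seteqP; split=> [[t w] /= h|[t w] [k _ [/= It h]]].
    exists (Num.truncn (Num.max 0 t * n.+1%:R)) => //; split=> //=.
    by rewrite /I/= in_itv/=; apply: truncn_itv; rewrite mulr_ge0.
  by rewrite /u (@truncn_def _ _ k)//; move: It; rewrite /I/= in_itv.
move=> [t w] _ /=.
have /subspace_continuousP/(_ (Num.max 0 t)) := cx w.
rewrite /= in_itv/= m0 => /(_ isT) cxt.
have ucvg : u n t @[n --> \oo] --> Num.max 0 t.
  apply/cvgrPdist_le => e e0.
  have [N _ HN] := (cvgrPdist_lt _ _).1 (@cvg_harmonic R) e e0.
  have n0 n : (0 : R) < n.+1%:R by [].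
  exists N => // n Nn; have := HN n Nn; rewrite /= sub0r normrN /harmonic/= => hn.
  have hn' : `|n.+1%:R^-1| = n.+1%:R^-1 :> R by rewrite ger0_norm// invr_ge0.
  apply: le_trans (ltW hn); rewrite hn'.
  have := truncn_itv (mulr_ge0 (m0 t) (ltW (n0 n))) => /andP[h1 h2].
  rewrite ger0_norm /u; last by rewrite subr_ge0 ler_pdivrMr.
  rewrite lerBlDr -[X in X + _]mul1r -mulrDl ler_pdivlMr//.
  by rewrite addrC natr1 ltW.
apply: (cvg_comp _ _ _ cxt).
(* The paths are continuous only within the half-line, which suffices because [u n t] is
   nonnegative. *)
move=> A [e e0 He]; have /cvgrPdist_lt/(_ e e0)[N _ HN] := ucvg.
exists N => // n Nn; apply: He; last by rewrite /= in_itv/= u0.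
exact: HN.
Qed.

End JointMeasurability.

Section LocalTimeIntegral.
Context {dO : measure_display} {Omega : measurableType dO} {R : realType}.
Variable P : probability Omega R.
Variables (d : nat) (X Xt : 'I_d -> R -> {RV P >-> R}) (k : 'I_d -> nat) (e T : R).
Hypotheses (e0 : 0 < e) (T0 : 0 < T) (cX : continuous_paths X) (cXt : continuous_paths Xt).
Local Notation mu := (@lebesgue_measure R).

(** The integrand of the local time without the factor [(2 * pi) ^- d], made jointly measurable on
    the whole plane by the maxima, which do nothing on the square. *)
Definition fcos_path (z : (R * R) * Omega) : R :=
  \prod_l fcos e (k l) (X l (Num.max 0 z.1.1) z.2 - Xt l (Num.max 0 z.1.2) z.2).

Definition fcos_path_bound : R := \prod_l \int[mu]_y `|gmono e (k l) y|.

Lemma measurable_fcos_path : measurable_fun setT fcos_path.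
Proof.
apply: measurable_prod => l _; apply: (measurableT_comp (measurable_fcos (k l) e0)).
have m1 : measurable_fun setT (fun z : (R * R) * Omega => (z.1.1, z.2)).
  apply: measurable_fun_pair => //; exact: (measurableT_comp measurable_fst measurable_fst).
have m2 : measurable_fun setT (fun z : (R * R) * Omega => (z.1.2, z.2)).
  apply: measurable_fun_pair => //; exact: (measurableT_comp measurable_snd measurable_fst).
have mX (Y : 'I_d -> R -> {RV P >-> R}) : continuous_paths Y ->
    measurable_fun setT (fun z : R * Omega => Y l (Num.max 0 z.1) z.2).
  move=> cY; apply: (@measurable_continuous_paths _ _ _ (fun t w => Y l t w)).
    by move=> t _; exact: measurable_funP.
  exact: cY.
apply: measurable_funB.
- exact: (measurableT_comp (mX X cX) m1).
- exact: (measurableT_comp (mX Xt cXt) m2).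
Qed.

Lemma fcos_path_le z : `|fcos_path z| <= fcos_path_bound.
Proof.
by rewrite /fcos_path normr_prod; apply: ler_prod => l _; rewrite normr_ge0 fcos_bounded.
Qed.

(** The open square, since the sign of the covariances is assumed only at times strictly between 0
    and [T]. *)
Definition square_ind (q : R * R) : R := \1_`]0, T[ q.1 * \1_`]0, T[ q.2.

Lemma integrable_ind_itv (i : interval R) : (mu [set` i] < +oo)%E ->
  mu.-integrable setT (EFin \o (\1_[set` i] : R -> R)).
Proof.
move=> fi; apply/integrableP; split.
  by apply/measurable_EFinP; exact: measurable_indic.
rewrite (_ : (fun x => _) = (fun x => (\1_([set` i] : set R) x)%:E)).
  by rewrite integral_indic//= setIT.
by apply/funext => x; rewrite /= ger0_norm.
Qed.

(** Endpoints are null, so the closed intervals may be opened, and on nonnegative times the maxima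
    in [fcos_path] disappear; the iterated integral then becomes one over the product measure. *)
Lemma L_epsE w : L_eps X Xt k e T 0 w =
  (2 * pi) ^- d * \int[(mu \x mu)%E]_q (square_ind q * fcos_path (q, w)).
Proof.
pose f (q : R * R) := fcos_path (q, w).
pose C := fcos_path_bound.
have fC q : `|f q| <= C by exact: fcos_path_le.
have C0 : 0 <= C by rewrite (le_trans _ (fC (0, 0))).
have mf : measurable_fun setT f.
  exact: (measurableT_comp measurable_fcos_path (pair2_measurable w)).
have oI : (mu `]0%R, T[%classic < +oo)%E.
  apply: (@le_lt_trans _ _ T%:E); last exact: ltry.
  apply: eq_ind_r (fun z => (z <= _)%E) _ _ (lebesgue_measure_itv _).
  by rewrite /= lte_fin T0 -EFinB subr0.
have cI : (mu `[0%R, T]%classic < +oo)%E.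
  apply: (@le_lt_trans _ _ T%:E); last exact: ltry.
  apply: eq_ind_r (fun z => (z <= _)%E) _ _ (lebesgue_measure_itv _).
  by rewrite /= lte_fin T0 -EFinB subr0.
have oc (g : R -> R) : measurable_fun setT g ->
    \int[mu]_(t in `[0, T]) g t = \int[mu]_t (\1_`]0, T[ t * g t).
  move=> mg; have mg' A : measurable_fun A (EFin \o g).
    by apply: measurable_funTS; exact/measurable_EFinP.
  transitivity (\int[mu]_(t in `]0, T[) g t).
    by rewrite /Rintegral integral_itv_bndo_bndc// integral_itv_obnd_cbnd.
  rewrite Rintegral_mkcond; apply: eq_Rintegral => t _.
  by rewrite patchE indicE; case: ifP => _; rewrite ?mul1r ?mul0r.
(* The interval in [t] is a parameter because the closed one comes from the definition and the open
   one is the target. *)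
pose h (i : interval R) (q : R * R) := \1_[set` i] q.1 * \1_`]0, T[ q.2 * f q.
have mI (i : interval R) : measurable_fun setT (\1_[set` i] : R -> R).
  exact: measurable_indic.
have mh (i : interval R) : measurable_fun setT (h i).
  apply: measurable_funM => //; apply: measurable_funM.
    exact: (measurableT_comp (mI i) measurable_fst).
  exact: (measurableT_comp (mI `]0, T[) measurable_snd).
have hb i t s : `|h i (t, s)| <= (C * \1_[set` i] t) * \1_`]0, T[ s.
  rewrite /h /= !normrM mulrC -mulrA ler_pM//.
  by rewrite !ger0_norm.
have ii := integrable_ind_itv oI.
have ig (i : interval R) : (mu [set` i] < +oo)%E ->
    mu.-integrable setT (EFin \o (fun t => C * (\1_[set` i] : R -> R) t)).
  by move=> fi; apply: (@integrable_Zl _ _ R mu); exact: integrable_ind_itv.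
rewrite -(@dominated_product1 _ _ _ _ R mu mu (h `]0, T[) _ _ (mh _) (hb _) (ig _ oI) ii).
pose c : R := (2 * pi) ^- d; rewrite -/c.
pose H i t := \int[mu]_s h i (t, s).
have iH (i : interval R) : (mu [set` i] < +oo)%E -> mu.-integrable setT (EFin \o H i).
  by move=> fi; exact: (@dominated_integrable_F _ _ _ _ R mu mu _ _ _ (mh i) (hb i) (ig _ fi) ii).
have ifs t : mu.-integrable setT (EFin \o (fun s => \1_`]0, T[ s * f (t, s))).
  apply: (@integrable_le_EFin _ _ R mu _ (fun s => C * \1_`]0, T[ s)).
  - by apply: measurable_funM; [exact: mI|exact: (measurableT_comp mf (pair1_measurable t))].
  - by move=> s; rewrite normrM mulrC ler_pM// ger0_norm.
  - exact: ig.
have inner t : 0 <= t -> \int[mu]_(s in `[0, T])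
    mpartial k (heat_kernel e) (pos_at X t w - pos_at Xt s w + 0) =
    c * \int[mu]_s (\1_`]0, T[ s * f (t, s)).
  move=> t0.
  transitivity (\int[mu]_(s in `[0, T]) (c * f (t, s))).
    apply: eq_Rintegral => s; rewrite inE/= in_itv/= => /andP[s0 _].
    rewrite mpartial_heat_kernel// /fcos_prod -/c /f /fcos_path; congr (_ * _).
    by apply: eq_bigr => l _; rewrite !mxE addr0/= !max_r.
  rewrite oc -?RintegralZl//; first by apply: eq_Rintegral => s _; rewrite mulrCA.
  apply: measurable_funM => //; exact: (measurableT_comp mf (pair1_measurable t)).
rewrite /L_eps /path_local_time.
transitivity (\int[mu]_(t in `[0, T]) (c * H `[0, T] t)).
  apply: eq_Rintegral => t; rewrite inE/= => tI.
  rewrite inner; last by move: tI; rewrite in_itv/= => /andP[].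
  congr (_ * _); apply: eq_Rintegral => s _.
  by rewrite /h /= [\1_`[0, T] t]indicE mem_set// mul1r.
rewrite oc; last first.
  by apply: measurable_funM => //; apply: (@integrable_measurable _ _ R mu); exact: iH.
rewrite -RintegralZl//; last exact: iH oI.
apply: eq_Rintegral => t _; rewrite mulrCA; congr (_ * _).
have [tI|tI] := boolP (t \in (`]0, T[%classic : set R)); last first.
  rewrite [\1__ t]indicE (negbTE tI) mul0r (_ : (fun s => _) = cst 0).
    by rewrite Rintegral_cst ?mul0r.
  by apply/funext => s; rewrite /h /= [\1__ t]indicE (negbTE tI) !mul0r.
rewrite [\1__ t]indicE tI mul1r; apply: eq_Rintegral => s _.
rewrite /h /= ![\1__ t]indicE tI mem_set//.
by move: tI; rewrite inE/= !in_itv/= => /andP[/ltW -> /ltW ->].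
Qed.

End LocalTimeIntegral.

(** * Lower bounds *)

Section ProductLowerBound.
Context {R : realType}.
Variables (d : nat) (k : 'I_d -> nat).

Lemma prod_gpairN q (B D : R) : 0 < B -> ~~ odd (mdegree k) ->
  \prod_l gpair (k l) (- q) B D = \prod_l gpair (k l) q B D.
Proof.
move=> B0 ek; under eq_bigr do rewrite gpairN//.
by rewrite big_split/= -expr_sum -/(mdegree k) -signr_odd (negbTE ek) mul1r.
Qed.

Lemma prod_gpair_lb (q B D : R) : 0 <= q -> 0 < B -> 0 < D ->
  q ^+ mdegree k * expR (-4) ^+ d * (Num.sqrt B)^-1 ^+ d *
    (Num.sqrt D)^-1 ^+ (2 * mdegree k + d) <= \prod_l gpair (k l) q B D.
Proof.
move=> q0 B0 D0.
have -> : q ^+ mdegree k * expR (-4) ^+ d * (Num.sqrt B)^-1 ^+ d *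
    (Num.sqrt D)^-1 ^+ (2 * mdegree k + d) =
  \prod_l (q ^+ k l * (expR (-2) * (Num.sqrt B)^-1) *
    (expR (-2) * (Num.sqrt D)^-1 ^+ (2 * k l).+1)).
  rewrite !big_split/= !prodr_const !card_ord -!expr_sum -/(mdegree k).
  rewrite (_ : \sum_l (2 * k l).+1 = 2 * mdegree k + d)%N; last first.
    under eq_bigr do rewrite -addn1.
    by rewrite big_split/= -big_distrr/= sum1_card card_ord.
  rewrite (_ : expR (-4) = expR (-2) * expR (-2)) ?exprMn; first by ring.
  by rewrite -expRD; congr expR; ring.
apply: ler_prod => l _; rewrite gpair_lb// andbT.
by rewrite !mulr_ge0 ?exprn_ge0 ?expR_ge0// invr_ge0 sqrtr_ge0.
Qed.

(** For [q < 0] a factor with [k l] odd may be negative; when [mdegree k] is even the signs cancel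
    in the product and [q] may be replaced by [- q]. *)
Lemma prod_gpair_ge0 (q B D : R) : 0 < B -> 0 < D ->
  ~~ odd (mdegree k) \/ 0 <= q -> 0 <= \prod_l gpair (k l) q B D.
Proof.
have H q' : 0 <= q' -> 0 < B -> 0 < D -> 0 <= \prod_l gpair (k l) q' B D.
  move=> q0 B0 D0; apply: le_trans (prod_gpair_lb q0 B0 D0).
  by rewrite !mulr_ge0 ?exprn_ge0 ?expR_ge0// invr_ge0 sqrtr_ge0.
move=> B0 D0 [ek|q0]; last exact: H.
have [q0|q0] := leP 0 q; first exact: H.
by rewrite -prod_gpairN// H// oppr_ge0 ltW.
Qed.

End ProductLowerBound.

(** * A time window on which the covariance is bounded below *)

Section CovarianceNear.
Context {dO : measure_display} {Omega : measurableType dO} {R : realType}.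
Variable P : probability Omega R.
Variable d : nat.

(** On a window short enough that increments are small compared with the variance [v] at [t0], all
    variances stay comparable to [v], and so do the covariances. The length is [2 * del] because the
    second time runs up to [del] beyond the first. *)
Lemma covariance_near (X : 'I_d -> R -> {RV P >-> R}) (H T : R) (l : 'I_d) :
  gaussian_process X -> centered X -> property_P1 H X -> 0 < T -> 0 < H ->
  exists t0 del v M kk : R, [/\ 0 < t0, 0 < del, t0 + 2 * del < T, 0 < v & 0 < kk] /\
    [/\ 0 < M, forall t t', t0 <= t <= t0 + 2 * del -> t0 <= t' <= t0 + 2 * del ->
        v <= rcov X l t t' /\ rcov X l t t <= M &
      forall t t', t0 <= t <= t0 + 2 * del -> t <= t' <= t0 + 2 * del ->
        rcov X l t t + rcov X l t' t' - 2 * rcov X l t t' <= kk * (t' - t) `^ (2 * H)].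
Proof.
move=> gX cX P1 T0 H0; have [k1 [k2 [k10 k12 P1T]]] := P1 T T0.
have k20 : 0 < k2 by exact: lt_le_trans k10 k12.
have H20 : 0 < 2 * H by lra.
have inc t t' : 0 <= t -> t < t' -> t' < T ->
    k1 * (t' - t) `^ (2 * H) <= rcov X l t t + rcov X l t' t' - 2 * rcov X l t t' /\
    rcov X l t t + rcov X l t' t' - 2 * rcov X l t t' <= k2 * (t' - t) `^ (2 * H).
  move=> t0 tt' t'T; have := P1T l t t' t0 tt' t'T.
  rewrite increment_cov//; last by lra.
  by rewrite !lee_fin (rcovC X l t' t) [rcov X l t' t' + _]addrC.
have inc2 t t' : 0 <= t -> t <= t' -> t' < T ->
    rcov X l t t + rcov X l t' t' - 2 * rcov X l t t' <= k2 * (t' - t) `^ (2 * H).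
  move=> t0; rewrite le_eqVlt => /orP[/eqP <- _|tt' t'T]; last by have [] := inc t t' t0 tt' t'T.
  by rewrite subrr powR0 ?gt_eqF// mulr0; lra.
(* The increment between [T / 3] and [T / 2] has positive second moment, at most twice the sum of
   the two variances, so one of these is positive. *)
have [t0 [t00 t0T v0]] : exists t0, [/\ 0 < t0, t0 <= T / 2 & 0 < rcov X l t0 t0].
  have a0 : 0 <= T / 3 by lra.
  have b0 : 0 <= T / 2 by lra.
  have [|||h _] := inc (T / 3) (T / 2); [lra..|].
  have q := @rcov_quad_ge0 _ _ _ P d X l (T / 3) (T / 2) 1 1 gX cX a0 b0.
  have p : 0 < k1 * (T / 2 - T / 3) `^ (2 * H) by rewrite mulr_gt0// powR_gt0//; lra.
  have [h2|h2] := ltP 0 (rcov X l (T / 3) (T / 3)).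
    by exists (T / 3); split; lra.
  by exists (T / 2); split; lra.
set v := rcov X l t0 t0 in v0.
(* Variances will be at least [v / 2 - eta = v / 3], so twice a covariance is at least
   [2 * (v / 3) - eta = v / 2]. *)
pose eta := v / 6.
(* The first bound keeps [t0 + 2 * del] below [T], the second makes [k2 * (2 * del) ^ (2 * H)] at
   most [eta]. *)
pose del := Num.min (T / 8) (2^-1 * (eta / k2) `^ (2 * H)^-1).
have eta0 : 0 < eta by rewrite divr_gt0.
have del0 : 0 < del.
  by rewrite lt_min divr_gt0//= mulr_gt0 ?powR_gt0 ?divr_gt0 ?invr_gt0.
have delT : del <= T / 8 by rewrite ge_min lexx.
have near t t' : t0 <= t -> t <= t' -> t' <= t0 + 2 * del ->
    k2 * (t' - t) `^ (2 * H) <= eta.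
  move=> h1 h2 h3; rewrite -ler_pdivlMl// [k2^-1 * eta]mulrC.
  have d2 : 2 * del <= (eta / k2) `^ (2 * H)^-1.
    by rewrite -ler_pdivlMl// ge_min lexx orbT.
  have E : eta / k2 = ((eta / k2) `^ (2 * H)^-1) `^ (2 * H).
    by rewrite -powRrM mulVf ?gt_eqF// powRr1// divr_ge0// ltW.
  rewrite E; apply: ge0_ler_powR; rewrite ?nnegrE ?powR_ge0//; first exact: ltW.
    by rewrite subr_ge0.
  by apply: le_trans d2; lra.
have vlb t : t0 <= t -> t <= t0 + 2 * del ->
    v / 2 - eta <= rcov X l t t /\ rcov X l t t <= 2 * v + 2 * eta.
  move=> h1 h2.
  have t_0 : 0 <= t by lra.
  have i1 : rcov X l t0 t0 + rcov X l t t - 2 * rcov X l t0 t <= eta.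
    by apply: le_trans (near t0 t _ _ _); rewrite ?inc2//; lra.
  (* The weights 1, -2 and -2, 1 bound the covariance with [X l t0] by both variances without square
     roots: one choice gives the lower bound on the variance at [t], the other the upper bound. *)
  have q1 := @rcov_quad_ge0 _ _ _ P d X l t0 t 1 (-2) gX cX (ltW t00) t_0.
  have q2 := @rcov_quad_ge0 _ _ _ P d X l t0 t (-2) 1 gX cX (ltW t00) t_0.
  by rewrite -/v in i1 q1 q2; split; lra.
exists t0, del, (v / 4), (2 * v + 2 * eta), k2; split; first by split=> //; lra.
split; first by lra.
  move=> t t' /andP[h1 h2] /andP[h3 h4].
  have [l1 u1] := vlb t h1 h2; have [l2 u2] := vlb t' h3 h4; split => //.
  wlog tt' : t t' h1 h2 h3 h4 l1 u1 l2 u2 / t <= t'.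
    move=> W; have [tt'|/ltW tt'] := leP t t'; first exact: W.
    by rewrite rcovC; exact: W.
  have : rcov X l t t + rcov X l t' t' - 2 * rcov X l t t' <= eta.
    by apply: le_trans (near t t' h1 tt' h4); apply: inc2 => //; lra.
  by rewrite /eta in l1 l2 *; lra.
move=> t t' /andP[h1 h2] /andP[h3 h4]; apply: inc2 => //; lra.
Qed.

End CovarianceNear.

(** * Dyadic rectangles *)

Section RectangleSums.
Context {R : realType}.
Local Notation mu := (@lebesgue_measure R).
Local Notation mu2 := (@lebesgue_measure R \x @lebesgue_measure R)%E.

Lemma lebesgue_itv_fin (i : interval R) (a b : R) : a <= b ->
  i.1 = BLeft a \/ i.1 = BRight a -> i.2 = BLeft b \/ i.2 = BRight b ->
  mu [set` i] = (b - a)%:E.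
Proof.
move=> ab h1 h2; apply: etrans (lebesgue_measure_itv _) _.
have -> : (i.1 : \bar R) = a%:E by case: h1 => ->.
have -> : (i.2 : \bar R) = b%:E by case: h2 => ->.
rewrite lte_fin; case: ltP => [_|ba]; first by rewrite EFinB.
by rewrite (@le_anti _ _ a b) ?ab// subrr.
Qed.

Lemma rect_indicator (i j : interval R) (a b a' b' : R) : a <= b -> a' <= b' ->
  i.1 = BLeft a \/ i.1 = BRight a -> i.2 = BLeft b \/ i.2 = BRight b ->
  j.1 = BLeft a' \/ j.1 = BRight a' -> j.2 = BLeft b' \/ j.2 = BRight b' ->
  mu2.-integrable setT (EFin \o (\1_([set` i] `*` [set` j]) : R * R -> R)) /\
  \int[mu2]_q \1_([set` i] `*` [set` j]) q = (b - a) * (b' - a').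
Proof.
move=> ab ab' h1 h2 h3 h4.
have mR : measurable ([set` i] `*` [set` j]) by apply: measurableX.
have E : mu2 ([set` i] `*` [set` j]) = ((b - a) * (b' - a'))%:E.
  rewrite EFinM -(lebesgue_itv_fin ab h1 h2) -(lebesgue_itv_fin ab' h3 h4).
  by apply: product_measure1E.
split.
  apply/integrableP; split.
    by apply/measurable_EFinP; exact: measurable_indic.
  rewrite (_ : (fun x => _) = (fun x => (\1_([set` i] `*` [set` j]) x)%:E)).
    by rewrite integral_indic//= setIT [X in (X < _)%E]E ltry.
  by apply/funext => x; rewrite /= ger0_norm.
by rewrite /Rintegral integral_indic//= setIT [X in fine X]E.
Qed.

Variables (H1 H2 : R) (N : nat).
Hypotheses (H10 : 0 < H1) (H20 : 0 < H2).
(* |t' - t| <= dyadic_scale H1 ^+ n and |s' - s| <= dyadic_scale H2 ^+ n make both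
   variances |t' - t|^(2 H1) and |s' - s|^(2 H2) at most 2^-n; the n-th rectangle
   then contributes dyadic_ratio ^+ n. *)
Definition dyadic_scale (H : R) : R := (2^-1 : R) `^ (2 * H)^-1.
Local Notation alpha := (dyadic_scale H1).
Local Notation beta := (dyadic_scale H2).
Definition dyadic_ratio : R :=
  dyadic_scale H1 * dyadic_scale H2 * (Num.sqrt (2^-1 : R))^-1 ^+ N.

Lemma dyadic_scale01 (H : R) : 0 < H -> 0 < dyadic_scale H < 1.
Proof.
move=> H0; rewrite powR_gt0//=.
have E : 1 `^ (2 * H)^-1 = 1 :> R by rewrite powR1.
rewrite -[X in _ < X]E; apply: gt0_ltr_powR; rewrite ?nnegrE//.
- by rewrite invr_gt0 mulr_gt0.
- by rewrite invf_lt1// ltr1n.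
Qed.

Lemma dyadic_scaleX (H u : R) n : 0 < H -> 0 <= u -> u <= dyadic_scale H ^+ n ->
  u `^ (2 * H) <= 2^-1 ^+ n.
Proof.
move=> H0 u0 un.
have H20' : 0 < 2 * H by rewrite mulr_gt0.
have -> : 2^-1 ^+ n = (dyadic_scale H ^+ n) `^ (2 * H) :> R.
  rewrite -[dyadic_scale H ^+ n]powR_mulrn ?powR_ge0// /dyadic_scale -!powRrM.
  rewrite (_ : _ * _ = n%:R); last by field; rewrite gt_eqF.
  by rewrite powR_mulrn// invr_ge0.
apply: ge0_ler_powR; rewrite ?nnegrE//; first exact: ltW.
by rewrite exprn_ge0// powR_ge0.
Qed.

(** The rectangles [A n] are disjoint because their time sides are, and have area
    [(1 - alpha) * alpha ^+ n * beta ^+ n]. On [A n] the three summands of [rho] are each at most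
    2^-n, the last one since [n <= m]; [n0] keeps the rectangles inside the window. *)
Lemma rect_sum_lb (G : R * R -> R) (t s kap e del : R) (m n0 : nat) :
  mu2.-integrable setT (EFin \o G) -> (forall q, 0 <= G q) -> 0 <= kap ->
  0 < e -> e <= 2^-1 ^+ m -> alpha ^+ n0 <= del -> beta ^+ n0 <= del ->
  (forall t' s', t <= t' <= t + del -> s <= s' <= s + del ->
    kap * (Num.sqrt ((t' - t) `^ (2 * H1) + (s' - s) `^ (2 * H2) + e))^-1 ^+ N
      <= G (t', s')) ->
  kap * (Num.sqrt 3)^-1 ^+ N * (1 - alpha) *
    \sum_(n0 <= n < m.+1) dyadic_ratio ^+ n <= \int[mu2]_q G q.
Proof.
move=> iG G0 kap0 e0 em adel bdel GL.
have /andP[a0 a1] := dyadic_scale01 H10.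
have /andP[b0 b1] := dyadic_scale01 H20.
pose I n := `]t + alpha ^+ n.+1, t + alpha ^+ n].
pose J n := `[s, s + beta ^+ n].
(* The lower bound at the largest value [3 * 2^-n] that [rho] can take on [A n]. *)
pose c n := kap * (Num.sqrt 3)^-1 ^+ N * (Num.sqrt (2^-1 : R))^-1 ^+ (n * N).
have c0 n : 0 <= c n by rewrite !mulr_ge0 ?exprn_ge0// invr_ge0 sqrtr_ge0.
pose A n := [set` I n] `*` [set` J n].
have aS n : alpha ^+ n.+1 <= alpha ^+ n by rewrite exprS ler_piMl ?exprn_ge0 ?ltW.
have RI n : mu2.-integrable setT (EFin \o (\1_(A n) : R * R -> R)) /\
    \int[mu2]_q \1_(A n) q = (alpha ^+ n - alpha ^+ n.+1) * beta ^+ n.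
  have := @rect_indicator (I n) (J n) (t + alpha ^+ n.+1) (t + alpha ^+ n) s (s + beta ^+ n).
  rewrite lerD2l aS lerDl exprn_ge0 ?ltW// => /(_ isT isT).
  have -> : t + alpha ^+ n - (t + alpha ^+ n.+1) = alpha ^+ n - alpha ^+ n.+1 by ring.
  have -> : s + beta ^+ n - s = beta ^+ n by ring.
  by apply; [right|right|left|right].
have disj n n' q : (n < n')%N -> A n q -> A n' q -> False.
  move=> nn' [/= h _] [/= h' _]; move: h h'; rewrite /I !in_itv/= => /andP[h _] /andP[_ h'].
  have : alpha ^+ n' <= alpha ^+ n.+1.
    by rewrite ler_wiXn2l// ltW.
  by lra.
have cA n : mu2.-integrable setT (EFin \o (fun q : R * R => c n * \1_(A n) q)).
  by apply: integrable_Zl; have [] := RI n.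
have -> : kap * (Num.sqrt 3)^-1 ^+ N * (1 - alpha) *
    \sum_(n0 <= n < m.+1) dyadic_ratio ^+ n =
    \int[mu2]_q \sum_(n0 <= n < m.+1) c n * \1_(A n) q.
  rewrite Rintegral_bigsum// mulr_sumr; apply: eq_bigr => n _.
  rewrite RintegralZl//; last by have [] := RI n.
  have [_ ->] := RI n; rewrite /c /dyadic_ratio !exprMn -exprM [(N * n)%N]mulnC exprS; ring.
apply: le_Rintegral => //; first exact: integrable_bigsum.
move=> [t' s'] _.
have [[n [nr An]]|noA] := pselect (exists n, n \in index_iota n0 m.+1 /\ A n (t', s')); last first.
  rewrite big_seq big1// => n nr; rewrite indicE memNset ?mulr0//.
  by move=> An; apply: noA; exists n.
rewrite (bigD1_seq n)//= ?iota_uniq// big1 ?addr0; last first.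
  move=> n' n'n; rewrite indicE memNset ?mulr0// => An'.
  by move: n'n; rewrite neq_ltn => /orP[h|h]; [exact: disj h An' An|exact: disj h An An'].
rewrite indicE mem_set// mulr1.
move: nr; rewrite mem_index_iota => /andP[n0n nm].
have [/= tI sJ] := An; move: tI sJ; rewrite /I /J !in_itv/= => /andP[h1 h2] /andP[h3 h4].
have an0 : alpha ^+ n <= alpha ^+ n0 by rewrite ler_wiXn2l// ltW.
have bn0 : beta ^+ n <= beta ^+ n0 by rewrite ler_wiXn2l// ltW.
have aSn : 0 < alpha ^+ n.+1 by rewrite exprn_gt0.
have an' : alpha ^+ n <= del by exact: le_trans adel.
have bn' : beta ^+ n <= del by exact: le_trans bdel.
move: (ltW aSn) h1 h2 h3 h4 an' bn' => aSn' h1 h2 h3 h4 an' bn'.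
apply: le_trans (GL t' s' _ _); last 2 first.
- by move: aSn' h1 h2 an'; clear; move=> *; apply/andP; split; lra.
- by move: h3 h4 bn'; clear; move=> *; apply/andP; split; lra.
rewrite /c -mulrA ler_wpM2l// exprM -exprMn lerXn2r ?nnegrE//.
set rho := _ + e.
have rho0 : 0 < rho by rewrite ltr_wpDl// addr_ge0// powR_ge0.
have ln0 : (0 : R) < 2^-1 ^+ n by rewrite exprn_gt0// invr_gt0.
have rho3 : rho <= 3 * 2^-1 ^+ n.
  have r1 : (t' - t) `^ (2 * H1) <= 2^-1 ^+ n.
    by apply: dyadic_scaleX => //; move: aSn' h1 h2; clear; move=> *; lra.
  have r2 : (s' - s) `^ (2 * H2) <= 2^-1 ^+ n.
    by apply: dyadic_scaleX => //; move: h3 h4; clear; move=> *; lra.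
  have r3 : e <= 2^-1 ^+ n.
    by apply: le_trans em _; rewrite ler_wiXn2l// ?invr_ge0// invf_le1// ler1n.
  by rewrite /rho; move: r1 r2 r3; clear; move=> *; lra.
rewrite exprVn -invfM lef_pV2 ?posrE ?sqrtr_gt0// ?mulr_gt0 ?exprn_gt0 ?sqrtr_gt0 ?invr_gt0//.
have -> : Num.sqrt 3 * Num.sqrt 2^-1 ^+ n = Num.sqrt (3 * 2^-1 ^+ n) :> R.
  rewrite sqrtrM//; congr (_ * _).
  rewrite -[LHS]ger0_norm ?exprn_ge0 ?sqrtr_ge0// -sqrtr_sqr -exprM mulnC exprM.
  by rewrite sqr_sqrtr// invr_ge0.
by rewrite ler_sqrt// mulr_gt0.
Qed.

End RectangleSums.

(** * Comparison of the rate with the geometric sum *)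

Section Rate.
Context {R : realType}.

Lemma dyadic_bracket (e : R) : 0 < e -> e <= 1 ->
  exists m, 2^-1 ^+ m.+1 < e <= 2^-1 ^+ m.
Proof.
move=> e0 e1.
have ex : exists m, (2^-1 : R) ^+ m.+1 < e.
  exists (Num.bound e^-1).
  rewrite exprVn -[X in _ < X]invrK ltf_pV2 ?posrE ?invr_gt0 ?exprn_gt0//.
  apply: lt_trans (archi_boundP _) _; first by rewrite invr_ge0 ltW.
  rewrite -natrX ltr_nat (leq_trans (ltn_expl (Num.bound e^-1) (ltnSn 1)))//.
  by rewrite leq_exp2l.
case: (ex_minnP ex) => m mP mmin; exists m; rewrite mP/=.
case: m mP mmin => [|m] _ mmin; first by rewrite expr0.
by rewrite leNgt; apply/negP => /mmin; rewrite ltnn.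
Qed.

(** The ratio is [2^-1] to the power [gam], the exponent in [h_rate], and [gam <= 0] restates the
    hypothesis on [crit]. If [gam < 0] the last term alone has the order of the rate; if [gam = 0]
    the sum counts its terms, which grows like the logarithm. *)
Lemma h_rate_le_sum (d K n0 : nat) (H1 H2 : R) : 0 < H1 -> 0 < H2 ->
  1 <= crit d K H1 H2 ->
  exists C e1 : R, [/\ 0 < C, 0 < e1 & forall e, 0 < e -> e < e1 ->
    exists m, [/\ e <= 2^-1 ^+ m, 0 < h_rate d K H1 H2 e &
     h_rate d K H1 H2 e <= C * \sum_(n0 <= n < m.+1) dyadic_ratio H1 H2 (2 * K + d) ^+ n]].
Proof.
move=> H10 H20 hcrit.
pose gam : R := (H1 + H2) / (2 * H1 * H2) - d%:R / 2 - K%:R.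
have l0 : (0 : R) < 2^-1 by rewrite invr_gt0.
have l1 : (2^-1 : R) <= 1 by rewrite invf_le1// ler1n.
have thE : dyadic_ratio H1 H2 (2 * K + d) = 2^-1 `^ gam.
  rewrite /dyadic_ratio /dyadic_scale -powR12_sqrt ?ltW// -powRN -powR_mulrn ?powR_ge0//.
  rewrite -!powRrM -!powRD; last 2 first.
  - by apply/implyP => _; rewrite gt_eqF.
  - by apply/implyP => _; rewrite gt_eqF.
  congr (_ `^ _); rewrite /gam natrD natrM; field.
  by rewrite !gt_eqF.
have critE : crit d K H1 H2 - 1 = - gam * (2 * H1 * H2 / (H1 + H2)).
  rewrite /crit /gam; field.
  by rewrite !gt_eqF// addr_gt0.
have p0 : 0 < 2 * H1 * H2 / (H1 + H2).
  by rewrite divr_gt0 ?mulr_gt0// addr_gt0.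
have [c1|c1] := ltP 1 (crit d K H1 H2).
  have g0 : gam < 0.
    have : 0 < - gam * (2 * H1 * H2 / (H1 + H2)) by rewrite -critE subr_gt0.
    by rewrite pmulr_lgt0// oppr_gt0.
  (* The constant pays for replacing [e] by 2^-m, at most a factor 2 larger than [e]; the threshold
     ensures that [n0 <= m], so the last term is in the sum. *)
  exists (2 `^ (- gam)), (2^-1 ^+ n0); split; [by rewrite powR_gt0|by rewrite exprn_gt0|].
  move=> e e0 en0.
  have e1 : e <= 1 by apply: ltW (lt_le_trans en0 _); rewrite exprn_ile1// ltW.
  have [m /andP[mlo mhi]] := dyadic_bracket e0 e1; exists m.
  rewrite /h_rate c1; split=> //; first by rewrite powR_gt0.
  have n0m : (n0 <= m)%N.
    rewrite leqNgt; apply/negP => mn0.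
    have : (2^-1 : R) ^+ n0 <= 2^-1 ^+ m.+1 by rewrite ler_wiXn2l// ltW.
    by move=> h; have := lt_le_trans (lt_trans mlo en0) h; rewrite ltxx.
  rewrite thE big_nat_recr//=.
  apply: (@le_trans _ _ (2 `^ (- gam) * (2^-1 `^ gam) ^+ m)); last first.
    rewrite ler_wpM2l ?powR_ge0// lerDr; apply: sumr_ge0 => n _.
    by apply: exprn_ge0; exact: powR_ge0.
  have -> : (2^-1 `^ gam) ^+ m = (2^-1 ^+ m) `^ gam :> R.
    rewrite -(powR_mulrn m (powR_ge0 2^-1 gam)) -(powR_mulrn m (ltW l0)) -!powRrM.
    by rewrite [gam * _]mulrC.
  have -> : (2^-1 ^+ m) `^ gam = ((2^-1 ^+ m)^-1) `^ (- gam) :> R.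
    by rewrite -(powR_inv1 (exprn_ge0 m (ltW l0))) -powRrM mulrNN mul1r.
  rewrite -powRM//.
  have -> : e `^ (gam) = e^-1 `^ (- gam).
    by rewrite -(powR_inv1 (ltW e0)) -powRrM mulrNN mul1r.
  apply: ge0_ler_powR.
  - by rewrite oppr_ge0 ltW.
  - by rewrite nnegrE invr_ge0 ltW.
  - by rewrite nnegrE mulr_ge0// invr_ge0 exprn_ge0// ltW.
  have := mlo; rewrite exprS => h.
  rewrite ler_pdivlMr ?exprn_gt0// ler_pdivrMl//.
  by move: (2^-1 ^+ m) h => x h; lra.
have g0 : gam = 0.
  have : - gam * (2 * H1 * H2 / (H1 + H2)) = 0.
    by rewrite -critE; apply/eqP; rewrite subr_eq0 eq_le c1.
  by move=> /eqP; rewrite mulf_eq0 (gt_eqF p0) orbF oppr_eq0 => /eqP.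
have th1 : dyadic_ratio H1 H2 (2 * K + d) = 1 by rewrite thE g0 powRr0.
(* The threshold forces [2 * n0 < m], so at least half of [m.+2] terms remain after dropping those
   below [n0]. *)
exists 2, (2^-1 ^+ (2 * n0).+2); split; [by []|by rewrite exprn_gt0|].
move=> e e0 en0.
have e1 : e <= 1 by apply: ltW (lt_le_trans en0 _); rewrite exprn_ile1// ltW.
have [m /andP[mlo mhi]] := dyadic_bracket e0 e1; exists m.
have cF : (1 < crit d K H1 H2) = false by rewrite ltNge c1.
rewrite /h_rate cF.
have n0m : (2 * n0 < m)%N.
  rewrite ltnNge; apply/negP => mn0.
  have : (2^-1 : R) ^+ (2 * n0).+2 <= 2^-1 ^+ m.+1.
    by rewrite ler_wiXn2l// ?ltW// !ltnS leqW.
  by move=> h; have := lt_le_trans (lt_trans mlo en0) h; rewrite ltxx.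
split=> //; first by rewrite ln_gt0// ltrDl powR_gt0.
have -> : \sum_(n0 <= n < m.+1) dyadic_ratio H1 H2 (2 * K + d) ^+ n = (m.+1 - n0)%:R.
  by rewrite th1; under eq_bigr do rewrite expr1n; rewrite sumr_const_nat.
apply: (@le_trans _ _ (ln (2 ^+ m.+2))).
  rewrite ler_ln ?posrE ?exprn_gt0//; last by rewrite ltr_wpDr ?powR_ge0.
  have h : e `^ (- (1 / 2)) <= 2 ^+ m.+1.
    apply: (@le_trans _ _ e^-1).
      by rewrite -(powR_inv1 (ltW e0)); apply: ger_powR; [rewrite e0 e1|lra].
    rewrite -[2 ^+ _]invrK lef_pV2 ?posrE ?invr_gt0 ?exprn_gt0//.
    by rewrite -exprVn ltW.
  rewrite [X in _ <= X]exprS mulr_natl mulr2n lerD//.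
  by apply: exprn_ege1; lra.
rewrite lnXn// -[leLHS]mulr_natr.
have l2 : ln 2 <= 1 :> R.
  have := @le_ln1Dx R 1; rewrite (_ : 1 + 1 = 2); last by ring.
  by apply; lra.
apply: (@le_trans _ _ m.+2%:R).
  by rewrite ler_piMl.
rewrite -(natrM _ 2) ler_nat; move: n0m; clear; lia.
Qed.

End Rate.

Lemma window_itv {R : realType} (T t0 de del t t' : R) : 0 < t0 -> t0 + 2 * de < T ->
  del <= de -> t0 <= t -> t <= t0 + del -> t <= t' -> t' <= t + del ->
  [/\ 0 < t < T, 0 < t' < T, t0 <= t <= t0 + 2 * de, t0 <= t' <= t0 + 2 * de &
      t <= t' <= t0 + 2 * de].
Proof. by move=> *; split; apply/andP; split; lra. Qed.

(** The residual variance of a linear prediction is at most the variance of the plain difference: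
    the Schur complement is bounded by [a + b - 2 * c + 2 * e]. *)
Lemma schur_complement_le {R : realType} (a b c k1 k2 u1 u2 e : R) :
  0 <= k1 -> 0 <= k2 -> 0 <= u1 -> 0 <= u2 -> 0 < e -> 0 < b + e ->
  a + b - 2 * c <= k1 * u1 + k2 * u2 ->
  a + e - c ^+ 2 / (b + e) <= (k1 + k2 + 2) * (u1 + u2 + e).
Proof.
move=> k10 k20 u10 u20 e0 B0 h.
(* (c - (b + e))^2 >= 0 *)
have h1 : 2 * c - (b + e) <= c ^+ 2 / (b + e).
  by rewrite ler_pdivlMr//; have := sqr_ge0 (c - (b + e)); lra.
have p1 : 0 <= k1 * u2 by rewrite mulr_ge0.
have p2 : 0 <= k2 * u1 by rewrite mulr_ge0.
have p3 : 0 <= k1 * e by rewrite mulr_ge0// ltW.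
have p4 : 0 <= k2 * e by rewrite mulr_ge0// ltW.
by move: (c ^+ 2 / (b + e)) h1 => x h1; lra.
Qed.

(** * Sign and size of the integrand of the second moment *)

Section PathProduct.
Context {dO : measure_display} {Omega : measurableType dO} {R : realType}.
Variable P : probability Omega R.
Variables (d : nat) (X Xt : 'I_d -> R -> {RV P >-> R}) (k : 'I_d -> nat).
Variables (T H1 H2 : R) (l0 : 'I_d).
Hypotheses (T0 : 0 < T) (hH1 : 0 < H1) (hH2 : 0 < H2).
Hypotheses (hX : in_class_G1 H1 X) (hXt : in_class_G1 H2 Xt)
  (hind : independent_processes X Xt).

Definition path_product (e : R) (q q' : R * R) : R :=
  \int[P]_w ((square_ind T q * fcos_path X Xt k e (q, w)) *
             (square_ind T q' * fcos_path X Xt k e (q', w))).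

Lemma square_indE (t s : R) :
  square_ind T (t, s) = if (0 < t < T) && (0 < s < T) then 1 else 0.
Proof.
rewrite /square_ind !indicE/=.
have E (x : R) : (x \in `]0, T[%classic) = (0 < x < T).
  by apply/idP/idP; rewrite inE/= in_itv.
by rewrite !E; case: (0 < t < T); case: (0 < s < T); rewrite ?mulr1 ?mulr0 ?mul0r.
Qed.

Lemma path_productE e t s t' s' : 0 < e ->
  0 < t < T -> 0 < s < T -> 0 < t' < T -> 0 < s' < T ->
  let a := rcov X l0 t t + rcov Xt l0 s s in
  let b := rcov X l0 t' t' + rcov Xt l0 s' s' in
  let c := rcov X l0 t t' + rcov Xt l0 s s' in
  [/\ 0 < b + e, e <= a + e - c ^+ 2 / (b + e) &
  path_product e (t, s) (t', s') =
  \prod_l gpair (k l) (c / (b + e)) (b + e) (a + e - c ^+ 2 / (b + e))].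
Proof.
move=> e0 /andP[t1 tT] /andP[s1 sT] /andP[t1' tT'] /andP[s1' sT'] a b c.
have [gX cX iX dX _] := hX; have [gY cY iY dY _] := hXt.
have [h1 h2 h3] := components_fcos_expectation k l0 e0 gX cX iX dX gY cY iY dY
  hind (ltW t1) (ltW t1') (ltW s1) (ltW s1').
split=> //; rewrite -h3; apply: eq_Rintegral => w _.
rewrite !square_indE t1 tT s1 sT t1' tT' s1' sT'/= !mul1r -big_split/=.
by apply: eq_bigr => l _; rewrite !max_r ?ltW.
Qed.

Lemma path_product_ge0 e q q' : 0 < e ->
  ~~ odd (mdegree k) \/ (forall s t : R, 0 < s < T -> 0 < t < T ->
    0 <= rcov X l0 t s /\ 0 <= rcov Xt l0 t s) ->
  0 <= path_product e q q'.
Proof.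
move: q q' => [t s] [t' s'] e0 hk.
have [|h] := boolP ((0 < t < T) && (0 < s < T)); last first.
  rewrite /path_product (@eq_Rintegral _ _ _ _ _ (fun=> 0)) ?Rintegral_cst//= ?mul0r// => w _.
  by rewrite square_indE (negbTE h) !mul0r.
move=> /andP[tT sT].
have [|h] := boolP ((0 < t' < T) && (0 < s' < T)); last first.
  rewrite /path_product (@eq_Rintegral _ _ _ _ _ (fun=> 0)) ?Rintegral_cst//= ?mul0r// => w _.
  by rewrite [X in _ * (X * _)]square_indE (negbTE h) mul0r mulr0.
move=> /andP[tT' sT'].
have [B0 D0 ->] := path_productE e0 tT sT tT' sT'.
apply: prod_gpair_ge0 => //; first exact: lt_le_trans D0.
case: hk => [hk|hk]; [by left|right].
rewrite divr_ge0//; last exact: ltW.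
have [p1 _] := hk _ _ tT' tT; have [_ p2] := hk _ _ sT' sT.
exact: addr_ge0.
Qed.

(** In [prod_gpair_lb] the three parameters are replaced by uniform bounds: [c / B] from below by
    [(v1 + v2) / B0], [B] from above by [B0], whose summand 1 covers [e <= 1], and [D] from above by
    [kk] times [rho]. *)
Lemma path_product_lb : exists t0 s0 del kap : R, [/\ 0 < del, 0 < kap &
  forall e, 0 < e -> e <= 1 -> forall t s t' s',
    t0 <= t <= t0 + del -> s0 <= s <= s0 + del ->
    t <= t' <= t + del -> s <= s' <= s + del ->
    kap * (Num.sqrt ((t' - t) `^ (2 * H1) + (s' - s) `^ (2 * H2) + e))^-1 ^+
      (2 * mdegree k + d) <= path_product e (t, s) (t', s')].
Proof.
have [gX cX _ _ pX] := hX; have [gY cY _ _ pY] := hXt.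
have [t0 [de1 [v1 [M1 [k1 [[t00 de10 t0T v10 k10] [M10 hX1 hX2]]]]]]] :=
  covariance_near l0 gX cX pX T0 hH1.
have [s0 [de2 [v2 [M2 [k2 [[s00 de20 s0T v20 k20] [M20 hY1 hY2]]]]]]] :=
  covariance_near l0 gY cY pY T0 hH2.
pose del := Num.min de1 de2.
have [d1 d2] : del <= de1 /\ del <= de2.
  by rewrite /del !ge_min !lexx orbT.
have del0 : 0 < del by rewrite /del lt_min de10.
pose B0 := M1 + M2 + 1; pose kk := k1 + k2 + 2.
have B00 : 0 < B0 by rewrite /B0; lra.
have kk0 : 0 < kk by rewrite /kk; lra.
pose kap := ((v1 + v2) / B0) ^+ mdegree k * expR (-4) ^+ d *
  (Num.sqrt B0)^-1 ^+ d * (Num.sqrt kk)^-1 ^+ (2 * mdegree k + d).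
have kap0 : 0 < kap.
  rewrite /kap !mulr_gt0// ?exprn_gt0 ?expR_gt0 ?invr_gt0 ?sqrtr_gt0//.
  by rewrite divr_gt0// addr_gt0.
exists t0, s0, del, kap; split=> // e e0 e1 t s t' s' /andP[ht1 ht2] /andP[hs1 hs2].
move=> /andP[ht3 ht4] /andP[hs3 hs4].
have [t1 t1' t2 t2' t2''] := window_itv t00 t0T d1 ht1 ht2 ht3 ht4.
have [s1 s1' s2 s2' s2''] := window_itv s00 s0T d2 hs1 hs2 hs3 hs4.
have [B1 D1 ->] := path_productE e0 t1 s1 t1' s1'.
have [va vaM] := hX1 t' t' t2' t2'.
have [wa waM] := hY1 s' s' s2' s2'.
have [vc _] := hX1 t t' t2 t2'.
have [wc _] := hY1 s s' s2 s2'.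
have iX := hX2 t t' t2 t2''.
have iY := hY2 s s' s2 s2''.
have uX : 0 <= (t' - t) `^ (2 * H1) by exact: powR_ge0.
have uY : 0 <= (s' - s) `^ (2 * H2) by exact: powR_ge0.
move: (rcov X l0 t t) (rcov X l0 t' t') (rcov X l0 t t') (rcov Xt l0 s s)
  (rcov Xt l0 s' s') (rcov Xt l0 s s') ((t' - t) `^ (2 * H1)) ((s' - s) `^ (2 * H2))
  B1 D1 va vaM wa waM vc wc iX iY uX uY.
move=> a1 b1 c1 a2 b2 c2 u1 u2 B1 D1 va vaM wa waM vc wc iX iY uX uY.
set B := b1 + b2 + e in B1 D1 *; set c := c1 + c2 in D1 *.
set D := _ - c ^+ 2 / B in D1 *.
have Dp : 0 < D by exact: lt_le_trans D1.
have BB0 : B <= B0 by rewrite !lerD.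
have q0 : (v1 + v2) / B0 <= c / B.
  apply: ler_pM; rewrite ?lef_pV2 ?posrE ?invr_ge0 ?(ltW B00)//; last exact: lerD.
  by rewrite addr_ge0 ?ltW.
have Dle : D <= kk * (u1 + u2 + e).
  have h : a1 + a2 + (b1 + b2) - 2 * c <= k1 * u1 + k2 * u2.
    by rewrite /c mulrDr (le_trans _ (lerD iX iY))// le_eqVlt; apply/orP/or_introl/eqP; ring.
  exact: schur_complement_le (ltW k10) (ltW k20) uX uY e0 B1 h.
have cB0 : 0 <= c / B by apply: le_trans q0; rewrite divr_ge0 ?ltW// addr_gt0.
apply: le_trans (prod_gpair_lb k cB0 B1 Dp).
have rho0 : 0 < u1 + u2 + e by rewrite ltr_wpDl// addr_ge0.
rewrite /kap -!mulrA -exprMn -invfM -sqrtrM ?(ltW kk0)//.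
have sB : 0 < Num.sqrt B by rewrite sqrtr_gt0.
have sB0 : 0 < Num.sqrt B0 by rewrite sqrtr_gt0.
have sD : 0 < Num.sqrt D by rewrite sqrtr_gt0.
have v12 : 0 <= (v1 + v2) / B0 by rewrite divr_ge0 ?ltW// addr_gt0.
have srt : 0 <= Num.sqrt (kk * (u1 + u2 + e)) by rewrite sqrtr_ge0.
apply: ler_pM.
- exact: exprn_ge0.
- by rewrite !mulr_ge0 ?exprn_ge0 ?expR_ge0 ?invr_ge0 ?sqrtr_ge0.
- by apply: lerXn2r; rewrite ?nnegrE.
rewrite ler_wpM2l ?exprn_ge0 ?expR_ge0//.
apply: ler_pM; rewrite ?exprn_ge0 ?invr_ge0 ?(ltW sB0)//.
- apply: lerXn2r; rewrite ?nnegrE ?invr_ge0 ?(ltW sB0) ?(ltW sB)//.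
  by rewrite lef_pV2 ?posrE//; apply: ler_wsqrtr.
- apply: lerXn2r; rewrite ?nnegrE ?invr_ge0 ?(ltW sD)//.
  by rewrite lef_pV2 ?posrE ?sqrtr_gt0 ?mulr_gt0//; apply: ler_wsqrtr.
Qed.

End PathProduct.

Lemma product_sigma_finite d1 d2 (T1 : measurableType d1) (T2 : measurableType d2)
    (R : realType) (m1 : {sigma_finite_measure set T1 -> \bar R})
    (m2 : {sigma_finite_measure set T2 -> \bar R}) : sigma_finite setT (m1 \x m2)%E.
Proof.
have /sigma_finiteP[F [FT Fnd Foo]] := sigma_finiteT m1.
have /sigma_finiteP[G [GT Gnd Goo]] := sigma_finiteT m2.
exists (fun n => F n `*` G n) => [|n].
  rewrite -setXTT FT GT; apply/seteqP; split=> [[x y] [/= [n _ Fx] [k _ Gy]]|].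
    exists (maxn n k) => //; split=> /=.
    - exact: (subsetPset _ _ (Fnd _ _ (leq_maxl n k))).
    - exact: (subsetPset _ _ (Gnd _ _ (leq_maxr n k))).
  by move=> [x y] [n _ [/= Fx Gy]]; split; exists n.
have [mF Fn] := Foo n; have [mG Gn] := Goo n; split; first exact: measurableX.
by rewrite product_measure1E// lte_mul_pinfty// ge0_fin_numE.
Qed.
(** Gives the measure on pairs [(t, s)] the structure under which [second_moment] is stated. *)
Definition sigma_finite_product d1 d2 (T1 : measurableType d1) (T2 : measurableType d2)
    (R : realType) (m1 : {sigma_finite_measure set T1 -> \bar R})
    (m2 : {sigma_finite_measure set T2 -> \bar R}) :
    {sigma_finite_measure set (T1 * T2)%type -> \bar R} :=
  HB.pack (m1 \x m2)%E
    (@Measure_isSigmaFinite.Build _ _ _ (m1 \x m2)%E (product_sigma_finite m1 m2)).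

(** * The second moment against the rate *)

Section SecondMomentLowerBound.
Context {dO : measure_display} {Omega : measurableType dO} {R : realType}.
Variable P : probability Omega R.
Local Notation mu := (@lebesgue_measure R).
Variables (d : nat) (X Xt : 'I_d -> R -> {RV P >-> R}) (k : 'I_d -> nat).
Variables (T H1 H2 : R) (l0 : 'I_d).
Hypotheses (T0 : 0 < T) (hH1 : 0 < H1) (hH2 : 0 < H2).
Hypotheses (hX : in_class_G1 H1 X) (hXt : in_class_G1 H2 Xt)
  (hind : independent_processes X Xt).
Hypotheses (hcX : continuous_paths X) (hcXt : continuous_paths Xt).
Hypothesis (hk : ~~ odd (mdegree k) \/ (forall s t : R, 0 < s < T -> 0 < t < T ->
    0 <= rcov X l0 t s /\ 0 <= rcov Xt l0 t s)).

Lemma square_ind_indic :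
  square_ind T = \1_([set` `]0, T[] `*` [set` `]0, T[]) :> (R * R -> R).
Proof.
by apply/funext => q; rewrite /square_ind !indicE in_setX; case: (_ \in _); rewrite ?mul1r ?mul0r.
Qed.

Local Notation m2 := (mu \x mu)%E.

Lemma L_eps_second_moment (e : R) : 0 < e ->
  [/\ ('E_P[(fun w => `|L_eps X Xt k e T 0 w| ^+ 2)%R])%E =
    (((2 * pi) ^- d) ^+ 2 *
      \int[(mu \x mu)%E]_q \int[(mu \x mu)%E]_q' path_product X Xt k T e q q')%:E,
   (mu \x mu)%E.-integrable setT (EFin \o
     (fun q => \int[(mu \x mu)%E]_q' path_product X Xt k T e q q')) &
   forall q, (mu \x mu)%E.-integrable setT (EFin \o path_product X Xt k T e q)].
Proof.
move=> e0.
pose F (z : (R * R) * Omega) : R := square_ind T z.1 * fcos_path X Xt k e z.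
pose g (q : R * R) : R := fcos_path_bound k e * square_ind T q.
have [iS _] := rect_indicator (ltW T0) (ltW T0) (i := `]0, T[) (j := `]0, T[)
  (or_intror erefl) (or_introl erefl) (or_intror erefl) (or_introl erefl).
have ig : m2.-integrable setT (EFin \o g).
  by apply: integrable_Zl; rewrite square_ind_indic.
have mF : measurable_fun setT F.
  apply: measurable_funM; last exact: measurable_fcos_path.
  apply: measurableT_comp; last exact: measurable_fst.
  by rewrite square_ind_indic; apply: measurable_indic; exact: measurableX.
have Fg q w : `|F (q, w)| <= g q.
  have s0 : 0 <= square_ind T q by rewrite mulr_ge0.
  rewrite /F /g normrM (ger0_norm s0) mulrC ler_wpM2r//.
  exact: fcos_path_le.
pose sf := sigma_finite_product mu mu.
split.
- rewrite (_ : (fun w => _) = (fun w => ((2 * pi) ^- d) ^+ 2 *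
      (\int[m2]_q F (q, w)) ^+ 2)); last first.
    by apply/funext => w; rewrite L_epsE// real_normK ?num_real// exprMn.
  have i2 := @second_moment_integrable _ _ _ _ _ sf P F g mF Fg ig.
  rewrite expectation_Rintegral; last exact: integrable_Zl.
  by rewrite RintegralZl// (@second_moment _ _ _ _ _ sf P F g mF Fg ig).
- exact: (@second_moment_integrable1 _ _ _ _ _ sf P F g mF Fg ig).
- exact: (@second_moment_integrable2 _ _ _ _ _ sf P F g mF Fg ig).
Qed.

(** Nonnegativity of [path_product] allows all base points [(t, s)] outside the small rectangle [Rt]
    to be dropped, and for each base point inside it all [(t', s')] outside the dyadic
    rectangles. *)
Lemma L_eps_second_moment_lb : 1 <= crit d (mdegree k) H1 H2 ->
  exists c e1 : R, [/\ 0 < c, 0 < e1 & forall e, 0 < e -> e < e1 ->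
    0 < h_rate d (mdegree k) H1 H2 e /\
    ((c * h_rate d (mdegree k) H1 H2 e)%:E <=
      'E_P[(fun w => `|L_eps X Xt k e T 0 w| ^+ 2)%R])%E].
Proof.
move=> hcrit; set N := (2 * mdegree k + d)%N.
have [t0 [s0 [del [kap [del0 kap0 lb]]]]] :=
  path_product_lb k l0 T0 hH1 hH2 hX hXt hind.
have small (H : R) : 0 < H -> exists n0, forall n, (n0 <= n)%N -> dyadic_scale H ^+ n <= del.
  move=> H0; have /andP[a0 a1] := dyadic_scale01 H0.
  have : `|dyadic_scale H| < 1 by rewrite gtr0_norm.
  move=> /(@cvg_expr R)/cvgrPdist_le/(_ _ del0)[n0 _ h].
  exists n0 => n /h; rewrite sub0r normrN ger0_norm//.
  by rewrite exprn_ge0// ltW.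
have [n1 h1] := small _ hH1; have [n2 h2] := small _ hH2.
pose n0 := maxn n1 n2.
have hn1 := h1 n0 (leq_maxl n1 n2); have hn2 := h2 n0 (leq_maxr n1 n2).
have [C [e1 [C0 e10 rate]]] := h_rate_le_sum n0 hH1 hH2 hcrit.
pose c1 := kap * (Num.sqrt 3)^-1 ^+ N * (1 - dyadic_scale H1).
have c10 : 0 < c1.
  have /andP[a0 a1] := dyadic_scale01 hH1.
  by rewrite /c1 !mulr_gt0 ?exprn_gt0 ?invr_gt0 ?sqrtr_gt0 ?subr_gt0.
pose p := ((2 * pi : R) ^- d) ^+ 2.
have p0 : 0 < p by rewrite exprn_gt0// invr_gt0 exprn_gt0// mulr_gt0// pi_gt0.
(* [p] comes from the Fourier normalisation, [c1] from the dyadic rectangles, [del ^+ 2] is the area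
   of the base points and [C] compares the sum with the rate. *)
pose c := p * (c1 * del ^+ 2 / C).
have cp : 0 < c by exact: mulr_gt0 p0 (divr_gt0 (mulr_gt0 c10 (exprn_gt0 _ del0)) C0).
exists c, (Num.min 1 e1); split=> //; first by rewrite lt_min ltr01.
move=> e e0; rewrite lt_min => /andP[/ltW e_1 ee1].
have [m [em h0 hS]] := rate e e0 ee1; split=> //.
have [-> iq1 iq2] := L_eps_second_moment e0.
have pp0 q q' : 0 <= path_product X Xt k T e q q'.
  exact: (path_product_ge0 hX hXt hind q q' e0 hk).
set S := \sum_(n0 <= n < m.+1) _ in hS.
pose Rt := [set` `[t0, t0 + del]] `*` [set` `[s0, s0 + del]].
have [iR ER] : (mu \x mu)%E.-integrable setT (EFin \o (\1_Rt : R * R -> R)) /\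
    \int[(mu \x mu)%E]_q \1_Rt q = del ^+ 2.
  have := @rect_indicator R `[t0, t0 + del] `[s0, s0 + del] t0 (t0 + del) s0 (s0 + del).
  rewrite !lerDl (ltW del0) => /(_ isT isT (or_introl erefl) (or_intror erefl)).
  move=> /(_ (or_introl erefl) (or_intror erefl))[-> ->]; split=> //; ring.
rewrite lee_fin -/p.
apply: (@le_trans _ _ (p * (c1 * S * del ^+ 2))).
  have -> : c * h_rate d (mdegree k) H1 H2 e =
      p * (c1 * del ^+ 2) * (C^-1 * h_rate d (mdegree k) H1 H2 e) by rewrite /c; ring.
  have -> : p * (c1 * S * del ^+ 2) = p * (c1 * del ^+ 2) * S by ring.
  apply: ler_wpM2l; last by rewrite ler_pdivrMl.
  by apply: mulr_ge0 (ltW p0) (mulr_ge0 (ltW c10) _); rewrite exprn_ge0// ltW.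
rewrite ler_wpM2l ?(ltW p0)// -ER -RintegralZl//.
apply: le_Rintegral => //; first exact: integrable_Zl.
move=> [t s] _; rewrite indicE.
have [|_] := boolP ((t, s) \in Rt); last first.
  by rewrite mulr0; apply: Rintegral_ge0 => q' _; exact: pp0.
rewrite inE /Rt => -[/= tI sI]; rewrite mulr1.
move: tI sI; rewrite !in_itv/= => tI sI.
apply: (rect_sum_lb hH1 hH2 (t := t) (s := s) (del := del) (e := e)) => //.
- exact: ltW.
- by move=> t' s' tI' sI'; exact: lb.
Qed.

End SecondMomentLowerBound.

Theorem theorem1p2 (R : realType) (dO : measure_display)
    (Omega : measurableType dO) (P : probability Omega R)
    (d : nat) (hd : (0 < d)%N) (T H1 H2 : R) (k : 'I_d -> nat)
    (X Xt : 'I_d -> R -> {RV P >-> R})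
    (hT : 0 < T) (hH1 : 0 < H1 < 1) (hH2 : 0 < H2 < 1)
    (hX : in_class_G1 H1 X) (hXt : in_class_G1 H2 Xt)
    (hind : independent_processes X Xt)
    (hcX : continuous_paths X) (hcXt : continuous_paths Xt)
    (hk : ~~ odd (mdegree k) \/
      (forall s t : R, 0 < s < T -> 0 < t < T ->
        (0 <= 'E_P[(fun w => X (Ordinal hd) t w * X (Ordinal hd) s w)%R])%E /\
        (0 <= 'E_P[(fun w => Xt (Ordinal hd) t w * Xt (Ordinal hd) s w)%R])%E))
    (hcrit : 1 <= crit d (mdegree k) H1 H2) :
  exists c3 : R, 0 < c3 /\
    (c3%:E <= limf_einf
      (fun eps : R => 'E_P[(fun w => `|L_eps X Xt k eps T 0 w| ^+ 2)%R]
                      / (h_rate d (mdegree k) H1 H2 eps)%:E)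
      0^'+)%E.
Proof.
have /andP[H10 _] := hH1; have /andP[H20 _] := hH2.
have hk' : ~~ odd (mdegree k) \/ (forall s t : R, 0 < s < T -> 0 < t < T ->
    0 <= rcov X (Ordinal hd) t s /\ 0 <= rcov Xt (Ordinal hd) t s).
  case: hk => [?|h]; [by left|right=> s t sT tT].
  have [hx hxt] := h s t sT tT.
  have [gX cX _ _ _] := hX; have [gY cY _ _ _] := hXt.
  case/andP: sT tT => /ltW s0 _ /andP[/ltW t0 _].
  move: hx hxt; rewrite !expectation_Rintegral//; last 2 first.
  - exact: integrable_cov.
  - exact: integrable_cov.
have [c [e1 [c0 e10 h]]] :=
  L_eps_second_moment_lb hT H10 H20 hX hXt hind hcX hcXt hk' hcrit.
(* The lower limit is a supremum of infima over neighbourhoods; the interval between 0 and [e1],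
   where the bound holds pointwise, is one of them. *)
exists c; split=> //; rewrite limf_einfE; apply: le_ereal_sup_tmp.
exists (ereal_inf [set ('E_P[(fun w => `|L_eps X Xt k eps T 0 w| ^+ 2)%R]
    / (h_rate d (mdegree k) H1 H2 eps)%:E)%E | eps in [set e | 0 < e < e1]]).
  exists [set e | 0 < e < e1] => //=.
  near=> e; apply/andP; split; first by near: e; exact: nbhs_right_gt.
  by near: e; exact: nbhs_right_lt.
apply: le_ereal_inf_tmp => _ [e /= /andP[e0 ee1] <-].
have [h0 he] := h e e0 ee1.
by rewrite inver (gt_eqF h0) lee_pdivlMr// -EFinM.
Unshelve. all: by end_near.
Qed.
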